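(* Let $d,n\ge 1$, let $\mathbf v^1,\dots,\mathbf v^n\in\mathbb R^d$, and let $\mu_{ij}\ge 0$ ($i,j\in\{1,\dots,n\}$, $i\ne j$) satisfy $\mu_{ij}=\mu_{ji}$ for all $i\neq j$. Let $\eta:\mathbb R\to\mathbb R$ be Lipschitz continuous and convex. Then each solution $\mathbf f=(f_1,\dots,f_n)$ to the system $$\frac{\partial f_i}{\partial t}+\mathbf v^i\cdot\nabla_{\mathbf x}f_i+\sum_{j\ne i}\bigl(\mu_{ij}f_i-\mu_{ji}f_j\bigr)=0,\qquad i=1,\dots,n,$$ for $\mathbf x\in\mathbb R^d$, $t>0$, is such that, whenever the right-hand side is finite, $$\sum_{i=1}^n\int_{\mathbb R^d}\eta(f_i)(\mathbf x,t_2)\,d\mathbf x\le\sum_{i=1}^n\int_{\mathbb R^d}\eta(f_i)(\mathbf x,t_1)\,d\mathbf x$$ for any $0\le t_1<t_2$.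
   Context: Solutions are understood in the mild sense: $\mathbf f\in C([0,\infty);[L^1_{\mathrm{loc}}(\mathbb R^d)]^n)$ and, for every $i$ and every $t\ge 0$, for a.e. $\mathbf x$, $$f_i(\mathbf x+\mathbf v^i t,t)=f_i(\mathbf x,0)+\int_0^t\sum_{j\ne i}\bigl(\mu_{ji}f_j-\mu_{ij}f_i\bigr)(\mathbf x+\mathbf v^i s,s)\,ds .$$ ''The right-hand side is finite'' means that each $\eta(f_i)(\cdot,t_1)$ is integrable on $\mathbb R^d$. *)

(* Defs.v *)
From HB Require Import structures.
From mathcomp Require Import all_boot all_order all_algebra.
From mathcomp Require Import all_classical all_reals all_analysis.

Set Implicit Arguments.
Unset Strict Implicit.
Unset Printing Implicit Defensive.

Import Order.TTheory GRing.Theory Num.Theory.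
Import numFieldNormedType.Exports.

Local Open Scope classical_set_scope.
Local Open Scope ring_scope.

Definition measure_rV_display : measure_display -> measure_display.
Proof. exact. Qed.

(* The product sigma-algebra on row vectors, i.e. the one generated by the
   coordinates (for T = R this is the Borel sigma-algebra of R^n). *)
Section measurable_rV.
Context {d} {T : sigmaRingType d}.
Variable n : nat.

Let coords : 'I_n -> 'rV[T]_n -> T := fun i x => x ord0 i.

Let rV_set0 : g_sigma_preimage coords set0.
Proof. exact: sigma_algebra0. Qed.

Let rV_setC A : g_sigma_preimage coords A -> g_sigma_preimage coords (~` A).
Proof. exact: sigma_algebraC. Qed.

Let rV_bigcup (F : _^nat) : (forall i, g_sigma_preimage coords (F i)) ->
  g_sigma_preimage coords (\bigcup_i (F i)).
Proof. exact: sigma_algebra_bigcup. Qed.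

HB.instance Definition _ := @isMeasurable.Build (measure_rV_display d)
  'rV[T]_n (g_sigma_preimage coords) rV_set0 rV_setC rV_bigcup.

End measurable_rV.

Lemma measurable_coord d (T : sigmaRingType d) n (i : 'I_n) :
  measurable_fun [set: 'rV[T]_n] (fun x => x ord0 i).
Proof.
move=> _ Y mY; rewrite setTI; apply: sub_sigma_algebra => /=.
rewrite -bigcup_seq/=; exists i => /=; first by rewrite mem_index_enum.
by exists Y => //; rewrite setTI.
Qed.

Lemma measurable_fun_coordP d1 d2 (T1 : measurableType d1)
    (T2 : measurableType d2) n (f : T1 -> 'rV[T2]_n) :
  measurable_fun [set: T1] f <->
  forall i, measurable_fun [set: T1] (fun x => f x ord0 i).
Proof.
apply: (@iff_trans _ (g_sigma_preimage
    (fun i => (fun y : 'rV[T2]_n => y ord0 i) \o f) `<=` measurable)).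
  rewrite g_sigma_preimage_comp; split=> [mf A [/= C preC <-]|prefS].
    exact: mf.
  by move=> _ A mA; apply: prefS; exists A.
split=> [coordfS i|mf].
- move=> _ A mA.
  apply: coordfS; apply: sub_sigma_algebra.
  rewrite -bigcup_seq/=; exists i => /=; first by rewrite mem_index_enum.
  by exists A.
- apply: smallest_sub; first exact: sigma_algebra_measurable.
  rewrite -bigcup_seq/=; apply: bigcup_sub => i _.
  by move=> A [B mB <-]; exact: mf.
Qed.

Section lebesgue_rV.
Context {R : realType}.

Definition cons_rV n (p : R * 'rV[R]_n) : 'rV[R]_n.+1 :=
  row_mx (p.1%:M : 'rV_1) p.2.

Lemma measurable_cons_rV n : measurable_fun [set: R * 'rV[R]_n] (@cons_rV n).
Proof.
apply/measurable_fun_coordP => i.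
have [j ->|j ->] := split_ordP (i : 'I_(1 + n)).
- rewrite (_ : (fun _ => _) = fst)//.
  apply/funext => p.
  by rewrite /cons_rV (@row_mxEl R 1 1 n) (ord1 j) mxE eqxx mulr1n.
- rewrite (_ : (fun _ => _) = (fun x : 'rV[R]_n => x ord0 j) \o snd).
    by apply: measurableT_comp => //; exact: measurable_coord.
  by apply/funext => p /=; rewrite /cons_rV (@row_mxEr R 1 1 n).
Qed.

Lemma cons_rV_surj n (x : 'rV[R]_n.+1) : exists p, cons_rV p = x.
Proof.
exists (lsubmx (x : 'rV_(1 + n)) ord0 ord0, rsubmx (x : 'rV_(1 + n))).
by rewrite /cons_rV /= -mx11_scalar hsubmxK.
Qed.

Section lebesgue_rVS.
Local Open Scope ereal_scope.
Variables (n : nat) (m : {sigma_finite_measure set 'rV[R]_n -> \bar R}).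

Definition lebesgue_rVS : set 'rV[R]_n.+1 -> \bar R :=
  pushforward ((@lebesgue_measure R) \x m) (@cons_rV n).

Let lebesgue_rVS0 : lebesgue_rVS set0 = 0.
Proof. by rewrite /lebesgue_rVS /pushforward preimage_set0 measure0. Qed.

Let lebesgue_rVS_ge0 A : 0 <= lebesgue_rVS A.
Proof. by rewrite /lebesgue_rVS /pushforward measure_ge0. Qed.

Let lebesgue_rVS_sigma_additive : semi_sigma_additive lebesgue_rVS.
Proof.
move=> F mF tF mUF; rewrite /lebesgue_rVS /pushforward preimage_bigcup.
apply: measure_semi_sigma_additive.
- by move=> k; rewrite -[X in measurable X]setTI; exact: measurable_cons_rV.
- apply/trivIsetP => /= i j _ _ ij; rewrite -preimage_setI.
  by move/trivIsetP : tF => /(_ _ _ _ _ ij) ->//; rewrite preimage_set0.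
- rewrite -preimage_bigcup -[X in measurable X]setTI.
  exact: measurable_cons_rV.
Qed.

HB.instance Definition _ := isMeasure.Build _ _ _ lebesgue_rVS
  lebesgue_rVS0 lebesgue_rVS_ge0 lebesgue_rVS_sigma_additive.

Let lebesgue_rVS_sigma_finite : sigma_finite [set: 'rV[R]_n.+1] lebesgue_rVS.
Proof.
have /sigma_finiteP[F [FT Fnd Foo]] := sigma_finiteT (@lebesgue_measure R).
have /sigma_finiteP[G [GT Gnd Goo]] := sigma_finiteT m.
pose H k : set 'rV[R]_n.+1 := [set x |
  F k ((x : 'rV_(1 + n)) ord0 (lshift n ord0)) /\ G k (rsubmx (x : 'rV_(1 + n)))].
have HE k : @cons_rV n @^-1` H k = F k `*` G k.
  apply/seteqP; split => -[a y] /=; rewrite /H /cons_rV /=;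
  by rewrite row_mxKr (@row_mxEl R 1 1 n) mxE eqxx mulr1n.
exists H.
  apply/seteqP; split => // x _.
  have [[a y] <-] := cons_rV_surj x.
  have [k1 _ Fk1] : (\bigcup_k F k) a by rewrite -FT.
  have [k2 _ Gk2] : (\bigcup_k G k) y by rewrite -GT.
  exists (maxn k1 k2) => //.
  have : (F (maxn k1 k2) `*` G (maxn k1 k2)) (a, y).
    split => /=.
      by move/subsetPset : (Fnd _ _ (leq_maxl k1 k2)); exact.
    by move/subsetPset : (Gnd _ _ (leq_maxr k1 k2)); exact.
  by rewrite -HE.
move=> k; have [mF Fk] := Foo k; have [mG Gk] := Goo k; split; last first.
  rewrite /lebesgue_rVS /pushforward HE product_measure1E//.
  by rewrite lte_mul_pinfty// ge0_fin_numE.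
rewrite /H; apply: measurableI.
  by rewrite -[X in measurable X]setTI; exact: measurable_coord.
rewrite -[X in measurable X]setTI.
have : measurable_fun setT (fun x : 'rV[R]_n.+1 => rsubmx (x : 'rV_(1 + n))).
  apply/measurable_fun_coordP => i.
  rewrite (_ : (fun _ => _) = fun x : 'rV[R]_n.+1 => x ord0 (rshift 1 i)).
    exact: measurable_coord.
  by apply/funext => x; rewrite mxE.
exact.
Qed.

HB.instance Definition _ := @Measure_isSigmaFinite.Build _ _ _
  lebesgue_rVS lebesgue_rVS_sigma_finite.

End lebesgue_rVS.

(* Lebesgue measure on R^n, as the n-fold product of the one on R; see
   [lebesgue_rV_box]. *)
Fixpoint lebesgue_rV n : {sigma_finite_measure set 'rV[R]_n -> \bar R} :=
  match n with
  | 0 => dirac (0 : 'rV[R]_0)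
  | n'.+1 => lebesgue_rVS (lebesgue_rV n')
  end.

Lemma lebesgue_rV_box n (a b : 'rV[R]_n) :
  (forall i, a ord0 i <= b ord0 i) ->
  lebesgue_rV n [set x | forall i, a ord0 i <= x ord0 i <= b ord0 i] =
  (\prod_(i < n) (b ord0 i - a ord0 i))%:E.
Proof.
have mbox k (c e : 'rV[R]_k) :
    measurable [set x : 'rV[R]_k | forall i, c ord0 i <= x ord0 i <= e ord0 i].
  rewrite (_ : mkset _ = \bigcap_(i in [set: 'I_k])
      ((fun x : 'rV[R]_k => x ord0 i) @^-1` `[c ord0 i, e ord0 i])).
    apply: fin_bigcap_measurable => // i _.
    by rewrite -[X in measurable X]setTI; exact: measurable_coord.
  apply/seteqP; split => x /= h i.
    by move=> _ /=; rewrite in_itv /=; exact: h.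
  by have := h i I; rewrite /= in_itv.
elim: n a b => [|n IH] a b ab.
  rewrite big_ord0 /= diracE mem_set//.
  by move=> -[].
rewrite big_ord_recl /= /lebesgue_rVS /pushforward.
pose a' := rsubmx (a : 'rV_(1 + n)); pose b' := rsubmx (b : 'rV_(1 + n)).
have E (c : 'rV[R]_n.+1) (i : 'I_n) :
    c ord0 (lift ord0 i) = rsubmx (c : 'rV_(1 + n)) ord0 i.
  by rewrite mxE; congr (c _ _); apply/val_inj.
rewrite (_ : _ @^-1` _ = `[a ord0 ord0, b ord0 ord0] `*`
    [set x : 'rV[R]_n | forall i, a' ord0 i <= x ord0 i <= b' ord0 i]).
  rewrite product_measure1E//=; last exact: mbox.
  rewrite IH; last by move=> i; rewrite /a' /b' -!E; exact: ab.
  rewrite lebesgue_measure_itv /= lte_fin -EFinB.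
  have -> : \prod_(i < n) (b' ord0 i - a' ord0 i) =
            \prod_(i < n) (b ord0 (lift ord0 i) - a ord0 (lift ord0 i)).
    by apply: eq_bigr => i _; rewrite !E.
  case: ltP => // ba.
  have -> : b ord0 ord0 = a ord0 ord0 by apply/eqP; rewrite eq_le ba ab.
  by rewrite subrr mul0r mul0e.
have c0 (p : R * 'rV[R]_n) : cons_rV p ord0 ord0 = p.1.
  have -> : cons_rV p ord0 ord0 = cons_rV p ord0 (lshift n (ord0 : 'I_1)).
    by congr (cons_rV p _ _); exact/val_inj.
  by rewrite /cons_rV (@row_mxEl R 1 1 n) mxE eqxx mulr1n.
have cS (p : R * 'rV[R]_n) i : cons_rV p ord0 (lift ord0 i) = p.2 ord0 i.
  by rewrite E /cons_rV row_mxKr.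
apply/seteqP; split => -[t y] /=.
  move=> h; split => [|i].
    by have := h ord0; rewrite c0 in_itv.
  by have := h (lift ord0 i); rewrite cS !E.
move=> [t01 h] i.
have [->|[j ->]] : i = ord0 \/ exists j, i = lift ord0 j.
  by case: (unliftP ord0 i) => [j ->|->]; [right; exists j|left].
  by rewrite c0; move: t01; rewrite in_itv.
by rewrite cS !E; exact: h.
Qed.

End lebesgue_rV.

(* Functions (not classes): [g] is a Borel representative of an element of
   L^1_loc(R^d). *)
Definition L1loc (R : realType) (d : nat) (g : 'rV[R]_d -> R) : Prop :=
  measurable_fun [set: 'rV[R]_d] g /\
  forall K : set 'rV[R]_d, compact K ->
    (lebesgue_rV d).-integrable K (EFin \o g).

Definition continuous_L1loc (R : realType) (d : nat)
    (u : 'rV[R]_d -> R -> R) : Prop :=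
  (forall t : R, 0 <= t -> L1loc (u ^~ t)) /\
  (forall t0 : R, 0 <= t0 -> forall K : set 'rV[R]_d, compact K ->
    (\int[lebesgue_rV d]_(x in K) `|u x t - u x t0|%:E)%E
      @[t --> within `[(0 : R), +oo[ (nbhs t0)] --> 0%E).

(* The joint measurability selects, as usual, a representative of
   f_i in C([0,oo); L^1_loc) as a function of (x,t): an arbitrary choice of
   representatives of the classes f_i(.,t), t >= 0, does not give a meaning to
   the time integral along the characteristics. *)
Record mild_solution (R : realType) (d n : nat) (v : 'I_n -> 'rV[R]_d)
    (mu : 'I_n -> 'I_n -> R) (f : 'I_n -> 'rV[R]_d -> R -> R) : Prop := {
  mild_measurable : forall i,
    measurable_fun ([set: 'rV[R]_d] `*` `[(0 : R), +oo[)
      (fun p : 'rV[R]_d * R => f i p.1 p.2) ;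
  mild_continuous : forall i, continuous_L1loc (f i) ;
  mild_eq : forall i (t : R), 0 <= t ->
    {ae lebesgue_rV d, forall x,
      f i (x + t *: v i) t = f i x 0 +
        \int[lebesgue_measure]_(s in `[0, t])
          \sum_(j < n | j != i)
            (mu j i * f j (x + s *: v i) s - mu i j * f i (x + s *: v i) s)} }.

(* Main.v *)
Require Import Defs.
From HB Require Import structures.
From mathcomp Require Import all_boot all_order all_algebra.
From mathcomp Require Import all_classical all_reals all_analysis.
From mathcomp Require Import measurable_realfun.
From mathcomp Require Import ring lra.

Set Implicit Arguments.
Unset Strict Implicit.
Unset Printing Implicit Defensive.

Import Order.TTheory GRing.Theory Num.Theory.
Import numFieldNormedType.Exports.

Local Open Scope classical_set_scope.
Local Open Scope ring_scope.

(* The entropy is dissipated along characteristics: convexity gives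
   eta'(f_i) mu_ij (f_j - f_i) <= mu_ij (eta(f_j) - eta(f_i)), and these terms
   cancel in the sum over i and j because mu is symmetric. No chain rule is
   needed: on a short time step [a, b] a subgradient of eta at the final value
   f_i(x + b v_i, b) gives the inequality with an error that is O(b - a)
   pointwise in time after integration against a compactly supported Lipschitz
   weight, hence O((b - a)^2) per step, and the errors vanish when the steps are
   summed and refined.
   Two families of weights are used. When eta >= 0, weights that decrease along
   all characteristics give the inequality for the whole space by monotone
   convergence; applied to eta^+ this bounds the integrals of eta^+. For general
   eta, weights that increase slowly (at rate O(1/r)) along the characteristics
   make the contribution of eta^- nonpositive and that of eta^+ O(1/r), and
   r -> oo. If some eta^-(f_i)(., t2) is not integrable, the left-hand side is
   -oo. *)

(** * Translation invariance *)

Section translation.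
Context {R : realType}.
Local Open Scope ereal_scope.

(** By uniqueness of Lebesgue measure it suffices to compare half-open intervals, whose length a
    translation preserves. *)
Lemma lebesgue_measure_shift (c : R) (A : set R) : measurable A ->
  pushforward lebesgue_measure ((fun x => x + c)%R : _ -> measurableTypeR R) A =
  lebesgue_measure A.
Proof.
move=> mA; apply/esym/lebesgue_measure_unique => //=.
  exact: measurable_funD.
move=> ? _ [[a b]] _ <-; rewrite /pushforward.
rewrite (_ : _ @^-1` _ = `](a - c)%R, (b - c)%R]%classic); last first.
  by apply/seteqP; split => x /=; rewrite !in_itv/= ltrBlDr lerBrDr.
rewrite /= !lebesgue_measure_itv/= !lte_fin ltrD2r.
by case: ifP => // _; rewrite -!EFinB; congr EFin; ring.
Qed.

Lemma ge0_integral_shiftR (c : R) (g : R -> \bar R) :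
  measurable_fun [set: R] g -> (forall x, 0 <= g x) ->
  \int[lebesgue_measure]_x g (x + c)%R = \int[lebesgue_measure]_x g x.
Proof.
move=> mg g0.
have := @ge0_integral_pushforward _ _ (measurableTypeR R) (measurableTypeR R) _
  (fun x => x + c)%R (measurable_funD (@measurable_id _ _ _) (measurable_cst c))
  lebesgue_measure setT g measurableT mg (fun x _ => g0 x).
rewrite preimage_setT => <-.
apply: eq_measure_integral => [? ?|mc A mA _]; first exact: measurable_funD.
exact: (lebesgue_measure_shift c).
Qed.

Lemma measurable_shift_rV d (c : 'rV[R]_d) :
  measurable_fun [set: 'rV[R]_d] (fun x => x + c)%R.
Proof.
apply/measurable_fun_coordP => i.
under eq_fun do rewrite mxE.
by apply: measurable_funD => //; exact: measurable_coord.
Qed.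

(** Induction on the dimension: [lebesgue_rV d.+1] is the image of a product measure under
    [cons_rV], so Tonelli splits off the first coordinate. The one-dimensional case shifts that
    coordinate, the induction hypothesis the others. *)
Lemma ge0_integral_shift d (c : 'rV[R]_d) (g : 'rV[R]_d -> \bar R) :
  measurable_fun [set: 'rV[R]_d] g -> (forall x, 0 <= g x) ->
  \int[lebesgue_rV d]_x g (x + c)%R = \int[lebesgue_rV d]_x g x.
Proof.
elim: d c g => [c g mg g0|d IH c g mg g0].
  by apply: eq_integral => x _; congr g; apply/rowP => -[].
have mcons : measurable_fun [set: measurableTypeR R * 'rV[R]_d] (@cons_rV R d).
  exact: measurable_cons_rV.
have step (h : 'rV[R]_d.+1 -> \bar R) : measurable_fun setT h ->
    (forall x, 0 <= h x) ->
    \int[lebesgue_rV d.+1]_x h x =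
    \int[lebesgue_measure]_a \int[lebesgue_rV d]_y h (cons_rV (a, y)).
  move=> mh h0.
  have := @ge0_integral_pushforward _ _ (measurableTypeR R * 'rV[R]_d)%type _ _ _
    mcons ((@lebesgue_measure R) \x lebesgue_rV d) setT h measurableT mh
    (fun x _ => h0 x).
  rewrite preimage_setT fubini_tonelli1/=.
  - by move=> <-; apply: eq_measure_integral.
  - exact: measurableT_comp.
  - by move=> ?; exact: h0.
rewrite step//; last first.
  by apply: measurableT_comp => //; exact: measurable_shift_rV.
rewrite step//.
have mgc : measurable_fun setT (g \o @cons_rV R d) by exact: measurableT_comp.
pose c0 : R := c ord0 ord0; pose c' := rsubmx (c : 'rV_(1 + d)).
have E a y : (cons_rV (a, y) + c)%R = cons_rV ((a + c0)%R, (y + c')%R).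
  rewrite /cons_rV/=; apply/rowP => i; rewrite mxE.
  have [j ->|j ->] := split_ordP (i : 'I_(1 + d)).
    rewrite !(@row_mxEl R 1 1 d) (ord1 j) !mxE eqxx !mulr1n.
    by congr (_ + c _ _)%R; exact/val_inj.
  by rewrite !(@row_mxEr R 1 1 d) !mxE.
under eq_integral => a _.
  under eq_integral do rewrite E.
  rewrite (IH c' (fun y => g (cons_rV ((a + c0)%R, y))))//.
  over.
  by apply: (@measurable_fun_pair2 _ _ _ _ _ _ (g \o @cons_rV R d)).
have := @ge0_integral_shiftR c0
  (fun a => \int[lebesgue_rV d]_y g (cons_rV (a, y))).
apply.
- apply: (measurable_fun_fubini_tonelli_F (g \o @cons_rV R d)) => // x.
  exact: g0.
- by move=> x; apply: integral_ge0 => y _; exact: g0.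
Qed.

Lemma integral_shift d (c : 'rV[R]_d) (g : 'rV[R]_d -> R) :
  measurable_fun [set: 'rV[R]_d] g ->
  (\int[lebesgue_rV d]_x g (x + c) = \int[lebesgue_rV d]_x g x)%R.
Proof.
move=> mg; congr fine; rewrite [LHS]integralE [RHS]integralE.
have mG : measurable_fun [set: 'rV[R]_d] (EFin \o g) by exact/measurable_EFinP.
have P := @ge0_integral_shift _ c _ (measurable_funepos mG) (fun x => funepos_ge0 _ x).
have N := @ge0_integral_shift _ c _ (measurable_funeneg mG) (fun x => funeneg_ge0 _ x).
congr (_ - _).
  by rewrite -[RHS]P; apply: eq_integral => x _; rewrite !funeposE.
by rewrite -[RHS]N; apply: eq_integral => x _; rewrite !funenegE.
Qed.

End translation.

(** * Balls for the sup norm *)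

Definition cball {R : realType} d (r : R) : set 'rV[R]_d := [set x | `|x| <= r].

Section cball.
Context {R : realType} {d : nat}.
Implicit Types (r : R) (x : 'rV[R]_d).

Lemma rV_norm_leP r x : 0 <= r ->
  (`|x| <= r) <-> (forall i, - r <= x ord0 i <= r).
Proof.
move=> r0; rewrite [`|x|]/Num.norm /= mx_normrE; split.
  by move/bigmax_leP => [_ h] i; rewrite -ler_norml; exact: (h (ord0, i)).
move=> h; apply/bigmax_leP; split => // -[i j] _.
by rewrite (ord1 i) /= ler_norml.
Qed.

Lemma measurable_norm_rV : measurable_fun [set: 'rV[R]_d] (fun x => `|x|).
Proof.
rewrite (_ : (fun x => _) =
    (fun x : 'rV[R]_d => \big[Num.max/0]_ij `|x ij.1 ij.2|)); last first.
  by apply/funext => x; rewrite [LHS]/Num.norm /= mx_normrE.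
elim: (index_enum _) => [|[i j] s IH].
  by under eq_fun do rewrite big_nil; exact: measurable_cst.
under eq_fun do rewrite big_cons.
apply: measurable_maxr => //=; rewrite (ord1 i).
by apply: measurableT_comp => //; exact: measurable_coord.
Qed.

Lemma measurable_cball r : measurable (cball r : set 'rV[R]_d).
Proof.
rewrite -[X in measurable X]setTI.
have -> : cball r = (fun x : 'rV[R]_d => `|x|) @^-1` `]-oo, r].
  by apply/seteqP; split => x; rewrite /cball/= in_itv.
exact: measurable_norm_rV.
Qed.

Lemma compact_cball r : compact (cball r : set 'rV[R]_d).
Proof.
apply: bounded_closed_compact.
  exists `|r|; split; first exact: num_real.
  move=> y ry x; rewrite /cball/= => /le_trans; apply.
  by rewrite (le_trans (ler_norm r))// ltW.
have -> : cball r = (fun x : 'rV[R]_d => `|x|) @^-1` [set y | y <= r] by [].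
apply: closed_comp; last exact: closed_le.
by move=> x _; exact: norm_continuous.
Qed.

(** For the sup norm a ball is a cube, so its volume is given by [lebesgue_rV_box]. *)
Lemma lebesgue_cball_lty r : (lebesgue_rV d (cball r) < +oo)%E.
Proof.
have [r0|r0] := leP 0 r; last first.
  rewrite (_ : cball r = set0) ?measure0//.
  by apply/seteqP; split => // x; rewrite /cball/= leNgt (lt_le_trans r0).
rewrite (_ : cball r = [set x : 'rV[R]_d |
    forall i, (const_mx (- r) : 'rV[R]_d) ord0 i <= x ord0 i
              <= (const_mx r : 'rV[R]_d) ord0 i]).
  rewrite lebesgue_rV_box ?ltry// => i.
  by rewrite !mxE (le_trans _ r0)// oppr_le0.
apply/seteqP; split => x; rewrite /cball/= => xr.
  by move=> i; rewrite !mxE; move: i; exact/rV_norm_leP.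
by apply/rV_norm_leP => // i; have := xr i; rewrite !mxE.
Qed.

Lemma subset_cball r s : r <= s -> cball r `<=` (cball s : set 'rV[R]_d).
Proof. by move=> rs x; rewrite /cball/= => /le_trans; exact. Qed.

End cball.

(** * Local L^1 bounds, uniform for bounded times *)

(** The working class of the proof: joint measurability serves Fubini, and the uniform bound gives
    the constants of a time step. One number [r] bounds both the ball and the times, and times range
    over all of [R]; see [locbnd_time_extension]. *)
Definition locbnd {R : realType} d (e : 'rV[R]_d -> R -> R) : Prop :=
  measurable_fun [set: 'rV[R]_d * R] (fun p => e p.1 p.2) /\
  forall r : R, exists C : R, forall s, `|s| <= r ->
    (\int[lebesgue_rV d]_(x in cball r) `|e x s|%:E <= C%:E)%E.

Section locbnd.
Context {R : realType} {d : nat}.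
Implicit Types (e f : 'rV[R]_d -> R -> R) (v : 'rV[R]_d).
Notation m := (@lebesgue_rV R d).

Lemma locbnd_slice e s : locbnd e -> measurable_fun [set: 'rV[R]_d] (e ^~ s).
Proof. by move=> [me _]; exact: (measurable_fun_pair1 s me). Qed.

Let mabs (g : 'rV[R]_d -> R) r : measurable_fun [set: 'rV[R]_d] g ->
  measurable_fun (cball r) (fun x => `|g x|%:E).
Proof.
move=> mg; apply/measurable_funTS/measurable_EFinP.
exact: measurableT_comp.
Qed.

Lemma locbnd_le e f : locbnd e ->
  measurable_fun [set: 'rV[R]_d * R] (fun p => f p.1 p.2) ->
  (forall x s, `|f x s| <= `|e x s|) -> locbnd f.
Proof.
move=> le mf fe; split=> // r; have [C Ce] := le.2 r; exists C => s rs.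
apply: le_trans (Ce s rs); apply: ge0_le_integral => //.
- exact: measurable_cball.
- exact: (mabs (measurable_fun_pair1 s mf)).
- exact: (mabs (locbnd_slice _ le)).
- by move=> x _; rewrite lee_fin.
Qed.

Lemma locbndD e f : locbnd e -> locbnd f -> locbnd (fun x s => e x s + f x s).
Proof.
move=> le lf; split; first exact: measurable_funD le.1 lf.1.
move=> r; have [C Ce] := le.2 r; have [D Df] := lf.2 r.
exists (C + D) => s rs; rewrite EFinD.
apply: le_trans (leeD (Ce s rs) (Df s rs)).
have me := locbnd_slice s le; have mf := locbnd_slice s lf.
rewrite -ge0_integralD//; [|exact: measurable_cball|exact: (mabs me)|exact: (mabs mf)].
apply: ge0_le_integral => //.
- exact: measurable_cball.
- exact: (mabs (measurable_funD me mf)).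
- by apply: emeasurable_funD; [exact: (mabs me)|exact: (mabs mf)].
- by move=> x _; rewrite -EFinD lee_fin ler_normD.
Qed.

Lemma locbndZ (k : R) e : locbnd e -> locbnd (fun x s => k * e x s).
Proof.
move=> le; split; first by apply: measurable_funM => //; exact: le.1.
move=> r; have [C Ce] := le.2 r; exists (`|k| * C) => s rs.
under eq_integral do rewrite normrM EFinM.
rewrite ge0_integralZl_EFin//; [|exact: measurable_cball|].
  by rewrite EFinM lee_wpmul2l ?lee_fin//; exact: Ce.
exact: (mabs (locbnd_slice _ le)).
Qed.

Lemma locbnd_cst (k : R) : locbnd (fun (_ : 'rV[R]_d) (_ : R) => k).
Proof.
split=> [|r]; first exact: measurable_cst.
exists (`|k| * fine (m (cball r))) => s rs.
rewrite integral_cst; last exact: measurable_cball.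
rewrite EFinM fineK//.
by rewrite ge0_fin_numE ?measure_ge0// lebesgue_cball_lty.
Qed.

Lemma locbnd_norm e : locbnd e -> locbnd (fun x s => `|e x s|).
Proof.
move=> le; apply: (locbnd_le le) => [|x s]; last by rewrite normr_id.
by apply: measurableT_comp => //; exact: le.1.
Qed.

Lemma locbndB e f : locbnd e -> locbnd f -> locbnd (fun x s => e x s - f x s).
Proof.
move=> le /(locbndZ (-1)) lf; have := locbndD le lf.
by congr locbnd; apply/funext => x; apply/funext => s; rewrite mulN1r.
Qed.

Lemma locbnd_sum (I : Type) (r : seq I) (P : pred I)
    (F : I -> 'rV[R]_d -> R -> R) :
  (forall i, P i -> locbnd (F i)) ->
  locbnd (fun x s => \sum_(i <- r | P i) F i x s).
Proof.
move=> lF; elim: r => [|i r IH].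
  have := locbnd_cst 0; congr locbnd.
  by apply/funext => x; apply/funext => s; rewrite big_nil.
case Pi : (P i).
  have := locbndD (lF _ Pi) IH; congr locbnd.
  by apply/funext => x; apply/funext => s; rewrite big_cons Pi.
move: IH; congr locbnd.
by apply/funext => x; apply/funext => s; rewrite big_cons Pi.
Qed.

Lemma locbnd_freeze e (t : R) : locbnd e -> locbnd (fun x _ => e x t).
Proof.
move=> le; split.
  by apply: (measurableT_comp (locbnd_slice t le)); exact: measurable_fst.
move=> r; pose r' := Num.max r `|t|; have [C Ce] := le.2 r'.
exists C => s rs; apply: le_trans (Ce t _); last by rewrite le_max lexx orbT.
apply: ge0_subset_integral => //; [exact: measurable_cball..| |].
  exact: (mabs (locbnd_slice _ le)).
by apply: subset_cball; rewrite le_max lexx.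
Qed.

(** A Lipschitz function grows at most affinely, [|eta u| <= |eta 0| + |L| |u|], and both terms on
    the right stay in the class. *)
Lemma locbnd_comp e (eta : R -> R) (L : R) : measurable_fun [set: R] eta ->
  (forall x y, `|eta x - eta y| <= L * `|x - y|) ->
  locbnd e -> locbnd (fun x s => eta (e x s)).
Proof.
move=> meta etaL le.
have lg := locbndD (locbnd_cst `|eta 0|) (locbndZ `|L| (locbnd_norm le)).
apply: (locbnd_le lg) => [|x s].
  by apply: (measurableT_comp meta); exact: le.1.
rewrite [leRHS]ger0_norm ?addr_ge0// -[X in `|X|](subrK (eta 0)).
rewrite addrC (le_trans (ler_normD _ _))// lerD2l (le_trans (etaL _ _))//.
by rewrite subr0 ler_wpM2r// ler_norm.
Qed.

Lemma measurable_trans v :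
  measurable_fun [set: 'rV[R]_d * R] (fun p => p.1 + p.2 *: v).
Proof.
apply/measurable_fun_coordP => i; under eq_fun do rewrite !mxE.
apply: measurable_funD.
  by apply: (measurableT_comp (measurable_coord i)); exact: measurable_fst.
by apply: measurable_funM => //; exact: measurable_snd.
Qed.

(** The translation by [c] maps the ball of radius [r] into the one of radius [r + |c|]; translation
    invariance does the rest. *)
Lemma integral_cball_shift (g : 'rV[R]_d -> R) (c : 'rV[R]_d) (r : R) :
  measurable_fun [set: 'rV[R]_d] g ->
  (\int[m]_(x in cball r) `|g (x + c)|%:E <=
   \int[m]_(x in cball (r + `|c|)) `|g x|%:E)%E.
Proof.
move=> mg; rewrite [leRHS]integral_mkcond.
have mG : measurable_fun [set: 'rV[R]_d]
    ((fun x => `|g x|%:E) \_ (cball (r + `|c|) : set 'rV[R]_d)).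
  apply/(measurable_restrictT _ _).1; first exact: measurable_cball.
  exact: (mabs mg).
rewrite -(ge0_integral_shift c mG); last by move=> x; apply: erestrict_ge0.
rewrite [leLHS]integral_mkcond; apply: ge0_le_integral => //.
- by move=> x _; apply: erestrict_ge0.
- apply/(measurable_restrictT _ _).1; first exact: measurable_cball.
  exact: (mabs (measurableT_comp mg (measurable_shift_rV c))).
- exact: (measurableT_comp mG (measurable_shift_rV c)).
move=> x _; rewrite !patchE; case: ifPn => [|_]; last first.
  by case: ifPn => _ //; rewrite lee_fin.
rewrite inE /cball/= => xr; rewrite mem_set//= (le_trans (ler_normD _ _))//.
by rewrite lerD2r.
Qed.

Lemma locbnd_trans e v : locbnd e -> locbnd (fun x s => e (x + s *: v) s).
Proof.
move=> le; split.
  have := measurableT_comp le.1 (measurable_fun_pair (measurable_trans v) measurable_snd).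
  exact.
(* Up to time [|r|] a characteristic starting in the ball of radius [r] travels at most
   [|r| * |v|]. *)
move=> r; pose r' := r + `|r| * `|v|; have [C Ce] := le.2 r'.
exists C => s rs; apply: le_trans (Ce s _); last first.
  by rewrite (le_trans rs)// lerDl mulr_ge0.
have me := locbnd_slice s le.
apply: le_trans (integral_cball_shift (s *: v) r me) _.
apply: ge0_subset_integral => //; [exact: measurable_cball..|exact: (mabs me)|].
apply: subset_cball; rewrite lerD2l normrZ ler_wpM2r//.
by rewrite (le_trans rs)// ler_norm.
Qed.

End locbnd.

(** * Integration in space and time *)

Section fubini.
Context {R : realType} {d : nat}.
Notation m := (@lebesgue_rV R d).
Notation lm := (@lebesgue_measure R).
Implicit Types (F : 'rV[R]_d -> R -> R) (r a b C : R).

Definition supported r F := forall x s, r < `|x| -> F x s = 0.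

Lemma ge0_integral_itv_le (H : R -> \bar R) a b C : a <= b -> 0 <= C ->
  (forall s, 0 <= H s)%E -> measurable_fun [set: R] H ->
  (forall s, a <= s <= b -> (H s <= C%:E)%E) ->
  (\int[lm]_(s in `[a, b]) H s <= (C * (b - a))%:E)%E.
Proof.
move=> ab C0 H0 mH HC; apply: (@le_trans _ _ (\int[lm]_(s in `[a, b]) C%:E)%E).
  by apply: ge0_le_integral => //; exact: measurable_funTS.
rewrite integral_cst; last exact: measurable_itv.
rewrite /= lebesgue_measure_itv/= lte_fin EFinM.
by case: ltP => // ba; rewrite mule0 -EFinM lee_fin mulr_ge0// subr_ge0.
Qed.

Lemma supported_integral F r s : supported r F ->
  (\int[m]_x `|F x s|%:E = \int[m]_(x in cball r) `|F x s|%:E)%E.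
Proof.
move=> sF; rewrite [RHS]integral_mkcond; apply: eq_integral => x _.
rewrite patchE; case: ifPn => //; rewrite notin_setE /cball/= => /negP.
by rewrite -ltNge => /sF ->; rewrite normr0.
Qed.

Lemma supported_bounded F r (T : R) : locbnd F -> supported r F ->
  exists2 C : R, 0 <= C &
    forall s, `|s| <= T -> (\int[m]_x `|F x s|%:E <= C%:E)%E.
Proof.
(* The maximum covers the support and the time interval with the single radius that [locbnd]
   offers. *)
move=> lF sF; have [C FC] := lF.2 (Num.max r T).
have sF' : supported (Num.max r T) F.
  by move=> x s; rewrite gt_max => /andP[/sF ->].
exists (Num.max C 0); first by rewrite le_max lexx orbT.
move=> s sT; rewrite (supported_integral s sF').
rewrite (le_trans (FC s _))//; first by rewrite le_max sT orbT.
by rewrite lee_fin le_max lexx.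
Qed.

Lemma supported_integrable F r s : locbnd F -> supported r F ->
  m.-integrable [set: 'rV[R]_d] (fun x => (F x s)%:E).
Proof.
move=> lF sF; have [C _ FC] := supported_bounded `|s| lF sF.
apply/integrableP; split.
  by apply/measurable_EFinP; have := locbnd_slice s lF.
by rewrite (le_lt_trans (FC s (lexx _)))// ltry.
Qed.

(** Fubini yields inner integrals in the extended reals, while [Rintegral] takes their [fine] part.
    An integrable function is finite almost everywhere, so the two agree under the outer
    integral. *)
Lemma integral_fine dT (T : measurableType dT) (mu : {measure set T -> \bar R})
    (D : set T) (Phi : T -> \bar R) :
  measurable D -> mu.-integrable D Phi ->
  mu.-integrable D (fun x => (fine (Phi x))%:E) /\
  (\int[mu]_(x in D) (fine (Phi x))%:E = \int[mu]_(x in D) Phi x)%E.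
Proof.
move=> mD iPhi; have mPhi := measurable_int _ iPhi.
have mfPhi : measurable_fun D (fun x => (fine (Phi x))%:E).
  by apply/measurable_EFinP; exact: measurableT_comp.
split.
  apply: (le_integrable mD mfPhi) iPhi => x _.
  by case: (Phi x) => [y| |] /=; rewrite ?lexx ?normr0 ?leey.
apply: ae_eq_integral => //.
have := integrable_ae mD iPhi; apply: filterS => x h Dx.
by rewrite fineK// h.
Qed.

Variables (F : 'rV[R]_d -> R -> R) (r a b : R).
Hypotheses (lF : locbnd F) (sF : supported r F) (ab : a <= b).

(** Restriction to [[a, b]] is built into the integrand, so that the product theorems apply on the
    whole product space. *)
Let G (p : 'rV[R]_d * measurableTypeR R) : \bar R :=
  (((F p.1) \_ `[a, b]) p.2)%:E.

Let mG : measurable_fun [set: 'rV[R]_d * measurableTypeR R] G.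
Proof.
apply/measurable_EFinP.
rewrite (_ : (fun p => _) =
  (fun p : 'rV[R]_d * measurableTypeR R => F p.1 p.2) \_ ([set: 'rV[R]_d] `*` `[a, b])).
  apply/(measurable_restrictT _ _).1; first exact: measurableX.
  exact: measurable_funTS lF.1.
apply/funext => p; rewrite !patchE; congr (if _ then _ else _).
by apply/idP/idP; rewrite !inE//= => -[].
Qed.

Let GE x : (fun s => G (x, s)) = (fun s => (F x s)%:E) \_ `[a, b].
Proof. by apply/funext => s; rewrite /G/= !patchE; case: ifP. Qed.

Let GE' s : (fun x => G (x, s)) = fun x => if s \in `[a, b] then (F x s)%:E else 0%E.
Proof.
by apply/funext => x; rewrite /G/= patchE mem_setE; case: ifP.
Qed.

(** Tonelli with time outermost: the space integral at each time of [[a, b]] is at most [C], so the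
    total is at most [C * (b - a)]. *)
Let iG : (m \x lm)%E.-integrable setT G.
Proof.
apply/integrable21ltyP => //.
have [C C0 FC] := supported_bounded (Num.max `|a| `|b|) lF sF.
rewrite (_ : (fun y => _) =
    (fun s => \int[m]_x `|F x s|%:E)%E \_ `[a, b]); last first.
  apply/funext => s; rewrite patchE mem_setE.
  transitivity (\int[m]_x `| if s \in `[a, b] then (F x s)%:E else 0%E |)%E.
    by apply: eq_integral => x _; rewrite -[G (x, s)]/((fun x => G (x, s)) x) GE'.
  case: ifP => _; first by [].
  by under eq_integral do rewrite abse0; rewrite integral0.
rewrite -integral_mkcond (@le_lt_trans _ _ (C * (b - a))%:E) ?ltry//.
apply: ge0_integral_itv_le => //.
- by move=> s; exact: integral_ge0.
- have := @measurable_fun_fubini_tonelli_G _ _ 'rV[R]_d (measurableTypeR R) R m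
    (fun p => `|F p.1 p.2|%:E) _ _.
  apply => //; apply/measurable_EFinP; apply: measurableT_comp => //.
  exact: lF.1.
- move=> s /andP[as_ sb]; apply: FC.
  rewrite ler_norml lerNl !le_max (le_trans sb (ler_norm b)) orbT andbT.
  by rewrite -[`|a|]normrN (le_trans _ (ler_norm _))// lerN2.
Qed.

Let intG1 x : (\int[lm]_s G (x, s) = \int[lm]_(s in `[a, b]) (F x s)%:E)%E.
Proof. by rewrite [RHS]integral_mkcond -GE. Qed.

Let intG2 : (fun s => \int[m]_x G (x, s))%E =
  ((fun s => \int[m]_x (F x s)%:E) \_ `[a, b])%E.
Proof.
apply/funext => s; rewrite patchE mem_setE.
transitivity (\int[m]_x (if s \in `[a, b] then (F x s)%:E else 0%E))%E.
  by apply: eq_integral => x _; rewrite -[G (x, s)]/((fun x => G (x, s)) x) GE'.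
by case: ifP => // _; rewrite integral0.
Qed.

Let iF1 : m.-integrable setT (fun x => \int[lm]_(s in `[a, b]) (F x s)%:E)%E.
Proof.
have := integrable_fubini_F iG.
by rewrite /fubini_F; under eq_fun do rewrite intG1.
Qed.

Let iF2 : lm.-integrable `[a, b] (fun s => \int[m]_x (F x s)%:E)%E.
Proof.
apply/integrable_mkcond => //; rewrite -intG2; apply/integrableP; split.
  exact: (measurable_fubini_G iG).
apply: le_lt_trans ((integrable21ltyP m lm mG).1 iG).
apply: ge0_le_integral => //.
- by apply: measurableT_comp => //; exact: (measurable_fubini_G iG).
- apply: (@measurable_fun_fubini_tonelli_G _ _ _ _ _ m (abse \o G)).
    exact: measurableT_comp.
  by move=> ?; exact: abse_ge0.
- move=> s _; apply: le_abse_integral => //.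
  exact: (measurable_fun_pair1 s mG).
Qed.

Lemma fubini_itv :
  \int[m]_x \int[lm]_(s in `[a, b]) F x s = \int[lm]_(s in `[a, b]) \int[m]_x F x s.
Proof.
rewrite /Rintegral; congr fine.
rewrite (integral_fine measurableT iF1).2 (integral_fine _ iF2).2//.
rewrite [RHS]integral_mkcond -intG2 -(Fubini iG).
by apply: eq_integral => x _; rewrite intG1.
Qed.

Lemma ae_integrable_itv :
  {ae m, forall x, lm.-integrable `[a, b] (fun s => (F x s)%:E)}.
Proof.
have := ae_integrable1 iG; apply: filterS => x.
by rewrite GE => /(integrable_mkcond _ _).2; apply.
Qed.

Lemma integrable_integral_itv :
  m.-integrable setT (fun x => (\int[lm]_(s in `[a, b]) F x s)%:E).
Proof. exact: (integral_fine measurableT iF1).1. Qed.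

Lemma integrable_itv_integral :
  lm.-integrable `[a, b] (fun s => (\int[m]_x F x s)%:E).
Proof. by apply: (integral_fine _ iF2).1. Qed.

End fubini.

(** * Integrability of traces in time, and extension of solutions to negative times *)

Section time_extension.
Context {R : realType} {d : nat}.
Notation m := (@lebesgue_rV R d).
Notation lm := (@lebesgue_measure R).

(** Fubini applies to [e] cut off by the indicator of each ball of integer radius. The countably
    many exceptional sets have a null union, and every [x] lies in one of the balls. *)
Lemma ae_integrable_trace (e : 'rV[R]_d -> R -> R) (a b : R) :
  locbnd e -> a <= b ->
  {ae m, forall x, lm.-integrable `[a, b] (fun s => (e x s)%:E)}.
Proof.
move=> le ab.
pose F k (x : 'rV[R]_d) (s : R) := \1_(cball k%:R) x * e x s.
have mi (k : nat) : measurable_fun setT (\1_(cball k%:R) : 'rV[R]_d -> R).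
  by apply: measurable_indic; exact: measurable_cball.
have lF k : locbnd (F k).
  apply: (locbnd_le le).
    apply: measurable_funM; last exact: le.1.
    by apply: (measurableT_comp (mi k)); exact: measurable_fst.
  move=> x s; rewrite /F normrM ler_piMl// indicE.
  by case: (_ \in _); rewrite ?normr1 ?normr0.
have sF k : supported k%:R (F k).
  move=> x s kx; rewrite /F indicE memNset ?mul0r// /cball/= => xk.
  by move: kx; rewrite ltNge xk.
have := ae_foralln (fun k => ae_integrable_itv (lF k) (@sF k) ab).
apply: filterS => x /(_ (Num.trunc `|x|).+1).
congr (_.-integrable _ _); apply/funext => s; rewrite /F indicE mem_set ?mul1r//.
by rewrite /cball/= ltW// truncnS_gt.
Qed.

(** By the reverse triangle inequality the L^1 norm over the ball is continuous in time, so it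
    attains a maximum on [[0, T]]. *)
Lemma continuous_L1loc_bounded (f : 'rV[R]_d -> R -> R) (r T : R) :
  continuous_L1loc f -> 0 <= T ->
  exists C : R, forall t, 0 <= t <= T ->
    (\int[m]_(x in cball r) `|f x t|%:E <= C%:E)%E.
Proof.
move=> [fL fC] T0; pose N t := \int[m]_(x in cball r) `|f x t|.
have mK : measurable (cball r : set 'rV[R]_d) := measurable_cball r.
have fint t : 0 <= t -> m.-integrable (cball r) (EFin \o f ^~ t).
  by move=> t0; apply: (fL t t0).2; exact: compact_cball.
have NE t : 0 <= t -> (\int[m]_(x in cball r) `|f x t|%:E = (N t)%:E)%E.
  move=> t0; rewrite /N fineK//; apply: integrable_fin_num => //.
  exact: (integrable_norm (fint t t0)).
have cN : {within `[0, T], continuous N}.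
  apply/subspace_continuousP => t0; rewrite /= in_itv/= => /andP[t00 t0T].
  have /fine_cvgP[_ Ct] := fC _ t00 _ (@compact_cball R d r).
  apply/cvgrPdist_le => /= eps eps0.
  move/cvgrPdist_le : Ct => /(_ _ eps0).
  rewrite !near_withinE; apply: filterS => t /= h.
  rewrite in_itv/= => /andP[t_0 tT].
  have {}h := h _; rewrite in_itv/= andbT in h; have {h} := h t_0.
  rewrite sub0r normrN; apply: le_trans.
  have iB : m.-integrable (cball r) (EFin \o (fun x => f x t - f x t0)).
    have := integrableB mK (fint _ t_0) (fint _ t00).
    by apply: eq_integrable => //= x _; rewrite EFinB.
  rewrite /N -RintegralB//; try exact: (integrable_norm (fint _ _)).
  have i1 := integrable_norm (fint _ t00); have i2 := integrable_norm (fint _ t_0).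
  apply: (le_trans (le_normr_Rintegral mK _)).
    have := integrableB mK i1 i2.
    by apply: eq_integrable => //= x _; rewrite EFinB.
  apply: (@le_trans _ _ (\int[m]_(x in cball r) `|f x t - f x t0|)); last exact: ler_norm.
  apply: le_Rintegral => //.
  - have := integrable_norm (integrableB mK i1 i2).
    by apply: eq_integrable => //= x _; rewrite EFinB.
  - exact: (integrable_norm iB).
  - move=> x _; rewrite distrC; exact: ler_dist_dist.
have [c _ cP] := EVT_max T0 cN.
by exists (N c) => t /andP[t0 tT]; rewrite NE// lee_fin cP// in_itv/= t0 tT.
Qed.

(** Negative times repeat the value at 0, which keeps measurability and the bounds while removing
    the restriction to nonnegative times. *)
Lemma locbnd_time_extension (f : 'rV[R]_d -> R -> R) :
  measurable_fun ([set: 'rV[R]_d] `*` `[(0 : R), +oo[) (fun p => f p.1 p.2) ->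
  continuous_L1loc f -> locbnd (fun x s => f x (Num.max 0 s)).
Proof.
move=> mf cf; split.
  apply: (@measurable_comp _ _ _ _ _ _ ([set: 'rV[R]_d] `*` `[(0 : R), +oo[)
    (fun p => f p.1 p.2) setT (fun p : 'rV[R]_d * R => (p.1, Num.max 0 p.2))) => //.
  - exact: measurableX.
  - by move=> _ [p _ <-]; split=> //=; rewrite in_itv/= andbT le_max lexx.
  - apply: measurable_fun_pair; first exact: measurable_fst.
    by apply: measurable_maxr => //; exact: measurable_snd.
move=> r; have [C fC] := continuous_L1loc_bounded r cf (normr_ge0 r).
exists C => s sr; apply: fC; rewrite le_max lexx ge_max normr_ge0/=.
by rewrite (le_trans (ler_norm s))// (le_trans sr)// ler_norm.
Qed.

End time_extension.

(** * Convex Lipschitz functions *)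

Section convex.
Context {R : realType}.
Implicit Types (eta : R -> R) (L : R).

Lemma lipschitzP eta : lipschitz eta ->
  exists2 L, 0 <= L & forall x y, `|eta x - eta y| <= L * `|x - y|.
Proof.
move=> /(pinfty_ex_gt (m := 0)) []; first exact: real0.
move=> L L0 etaL; exists L; first exact: ltW.
by move=> x y; exact: (etaL (x, y)).
Qed.

Lemma lipschitz_measurable eta L :
  (forall x y, `|eta x - eta y| <= L * `|x - y|) ->
  measurable_fun [set: R] eta.
Proof.
move=> etaL; apply: continuous_measurable_fun => x.
apply/cvgrPdist_le => eps eps0.
have L1 : 0 < `|L| + 1 by rewrite ltr_wpDl.
near=> y; apply: le_trans (etaL x y) _.
apply: (@le_trans _ _ ((`|L| + 1) * `|x - y|)).
  by rewrite ler_wpM2r// (le_trans (ler_norm L))// lerDl.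
rewrite -ler_pdivlMl// mulrC; near: y.
by apply: cvgr_dist_le; [exact: cvg_id|exact: divr_gt0].
Unshelve. all: by end_near. Qed.

Definition subgradient_at eta (u p : R) := forall w, eta u + p * (w - u) <= eta w.

Lemma convex_functionP eta : convex_function setT eta ->
  forall t x y, 0 <= t <= 1 ->
    eta (t * x + (1 - t) * y) <= t * eta x + (1 - t) * eta y.
Proof.
move=> ceta t x y /andP[t0 t1].
exact: (ceta (Itv01 t0 t1) x y (mem_set I) (mem_set I)).
Qed.

Lemma convex_slope_le eta (u w z : R) : convex_function setT eta ->
  w < u -> u < z -> (eta u - eta w) / (u - w) <= (eta z - eta u) / (z - u).
Proof.
move=> /convex_functionP ceta wu uz.
have wz0 : 0 < z - w by rewrite subr_gt0 (lt_trans wu).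
have t01 : 0 <= (z - u) / (z - w) <= 1.
  rewrite divr_ge0 ?subr_ge0 ?(ltW uz) ?(ltW (lt_trans wu uz))//=.
  by rewrite ler_pdivrMr// mul1r lerD2l lerN2 ltW.
(* Convexity is used at [u], written as the combination of [w] and [z] with weight
   [(z - u) / (z - w)] on [w]. *)
have := ceta _ w z t01.
have -> : (z - u) / (z - w) * w + (1 - (z - u) / (z - w)) * z = u.
  by field; rewrite gt_eqF.
rewrite -(ler_pM2l wz0).
have -> : (z - w) * ((z - u) / (z - w) * eta w + (1 - (z - u) / (z - w)) * eta z) =
  (z - u) * eta w + (u - w) * eta z by field; rewrite gt_eqF.
move=> h; rewrite ler_pdivrMr ?subr_gt0// mulrAC ler_pdivlMr ?subr_gt0//.
by lra.
Qed.

(** The slope is the supremum of the slopes to the left of [u]; by [convex_slope_le] every slope to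
    the right bounds that set from above. *)
Lemma convex_subgradient eta L :
  convex_function setT eta ->
  (forall x y, `|eta x - eta y| <= L * `|x - y|) ->
  forall u, exists2 p, `|p| <= L & subgradient_at eta u p.
Proof.
move=> ceta etaL u.
pose S := [set (eta u - eta w) / (u - w) | w in [set w | w < u]].
have Sub z : u < z -> ubound S ((eta z - eta u) / (z - u)).
  by move=> uz _ [w /= wu <-]; exact: convex_slope_le.
have S0 : S !=set0.
  by exists ((eta u - eta (u - 1)) / (u - (u - 1))), (u - 1) => //=; rewrite gtrDl ltrN10.
have supS : has_sup S by split=> //; eexists; apply: (Sub (u + 1)); rewrite ltrDl.
have sub : subgradient_at eta u (sup S).
  move=> w; have [wu|uw|->] := ltgtP w u; last by rewrite subrr mulr0 addr0.
    have : (eta u - eta w) / (u - w) <= sup S.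
      by apply: ub_le_sup supS.2 _ _; exists w.
    rewrite ler_pdivrMr ?subr_gt0//; lra.
  have : sup S <= (eta w - eta u) / (w - u) by apply: ge_sup => //; exact: Sub.
  rewrite ler_pdivlMr ?subr_gt0//; lra.
(* The bound [|p| <= L] is read off from the subgradient inequality at [u + 1] and [u - 1]. *)
exists (sup S) => //; rewrite ler_norml.
have := sub (u + 1); have := sub (u - 1).
have := etaL (u + 1) u; have := etaL (u - 1) u.
rewrite !(addrC u) !addrK normr1 normrN1 !ler_norml !mulr1 mulrN1.
by move=> /andP[? ?] /andP[? ?] ? ?; apply/andP; split; lra.
Qed.

End convex.

(** * Weights *)

Section integral_extra.
Context dT (T : measurableType dT) {R : realType}.
Variables (mu : {measure set T -> \bar R}) (D : set T) (mD : measurable D).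
Implicit Types f g : T -> R.

Lemma integrableB_EFin f g : mu.-integrable D (EFin \o f) ->
  mu.-integrable D (EFin \o g) ->
  mu.-integrable D (fun x => (f x - g x)%:E).
Proof.
move=> fi gi; have := integrableB mD fi gi.
by apply: eq_integrable => //= x _; rewrite EFinB.
Qed.

Lemma integrableZ_EFin (k : R) f : mu.-integrable D (EFin \o f) ->
  mu.-integrable D (fun x => (k * f x)%:E).
Proof.
move=> fi; have := integrableZl mD k fi.
by apply: eq_integrable => //= x _; rewrite EFinM.
Qed.

Lemma integrableD_EFin f g : mu.-integrable D (EFin \o f) ->
  mu.-integrable D (EFin \o g) ->
  mu.-integrable D (fun x => (f x + g x)%:E).
Proof.
move=> fi gi; have := integrableD mD fi gi.
by apply: eq_integrable => //= x _; rewrite EFinD.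
Qed.

(** The difference [g - f] agrees almost everywhere with [|g - f|], whose integral is
    nonnegative. *)
Lemma ae_le_Rintegral f g : mu.-integrable D (EFin \o f) ->
  mu.-integrable D (EFin \o g) ->
  {ae mu, forall x, D x -> f x <= g x} ->
  \int[mu]_(x in D) f x <= \int[mu]_(x in D) g x.
Proof.
move=> fi gi fg; rewrite -subr_ge0 -RintegralB//.
have gfi := integrableB_EFin gi fi.
have -> : \int[mu]_(x in D) (g x - f x) = \int[mu]_(x in D) `|g x - f x|.
  congr fine; apply: ae_eq_integral => //.
  - exact: measurable_int gfi.
  - exact: measurable_int (integrable_norm gfi).
  by apply: filterS fg => x fgx Dx; rewrite ger0_norm// subr_ge0 fgx.
by apply: Rintegral_ge0.
Qed.

Lemma integrable_sum_EFin (I : Type) (s : seq I) (P : pred I) (h : I -> T -> R) :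
  (forall i, P i -> mu.-integrable D (fun x => (h i x)%:E)) ->
  mu.-integrable D (fun x => (\sum_(i <- s | P i) h i x)%:E).
Proof.
move=> hi; under eq_fun do rewrite -sumEFin.
exact: integrable_sum.
Qed.

Lemma Rintegral_sum (I : Type) (s : seq I) (P : pred I) (h : I -> T -> R) :
  (forall i, P i -> mu.-integrable D (fun x => (h i x)%:E)) ->
  \int[mu]_(x in D) (\sum_(i <- s | P i) h i x) =
  \sum_(i <- s | P i) \int[mu]_(x in D) h i x.
Proof.
move=> hi; elim: s => [|i s IH].
  under eq_Rintegral do rewrite big_nil.
  by rewrite big_nil Rintegral_cst// mul0r.
rewrite big_cons; case: ifPn => Pi; last first.
  by rewrite -IH; apply: eq_Rintegral => x _; rewrite big_cons (negbTE Pi).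
under eq_Rintegral do rewrite big_cons Pi.
by rewrite RintegralD ?IH//; [exact: hi|exact: integrable_sum_EFin].
Qed.

Lemma Rintegral_normr_le f (c : R) : mu.-integrable D (EFin \o f) ->
  (\int[mu]_(x in D) `|f x|%:E <= c%:E)%E ->
  `|\int[mu]_(x in D) f x| <= c.
Proof.
move=> fi fc; apply: le_trans (le_normr_Rintegral mD fi) _.
rewrite -lee_fin /Rintegral fineK//; apply: integrable_fin_num => //.
exact: (integrable_norm fi).
Qed.

End integral_extra.

Lemma locbnd_unif {R : realType} d n (e : 'I_n -> 'rV[R]_d -> R -> R) (r : R) :
  (forall i, locbnd (e i)) ->
  exists2 K : R, 0 <= K & forall i s, `|s| <= r ->
    (\int[lebesgue_rV d]_(x in cball r) `|e i x s|%:E <= K%:E)%E.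
Proof.
move=> le; have [C eC] := choice (fun i => (le i).2 r).
exists (\sum_i `|C i|); first exact: sumr_ge0.
move=> i s sr; apply: (le_trans (eC i s sr)); rewrite lee_fin.
by rewrite (bigD1 i)//= (le_trans (ler_norm _))// lerDl sumr_ge0.
Qed.

(** * Compactly supported Lipschitz weights and their transport *)

Section weight.
Context {R : realType} {d : nat}.
Implicit Types (psi w : 'rV[R]_d -> R) (e : 'rV[R]_d -> R -> R).
Notation m := (@lebesgue_rV R d).

(** The support radius and the Lipschitz constant are parameters so that error constants can depend
    on them alone and serve a whole family of weights. *)
Definition is_weight (rho l : R) psi : Prop :=
  [/\ measurable_fun [set: 'rV[R]_d] psi,
      forall x, 0 <= psi x <= 1,
      forall x y, `|psi x - psi y| <= l * `|x - y| &
      forall x, rho < `|x| -> psi x = 0].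

Lemma is_weight_shift rho l psi (c : 'rV[R]_d) : is_weight rho l psi ->
  is_weight (rho + `|c|) l (fun x => psi (x + c)).
Proof.
move=> [mpsi psi01 psil psi0]; split=> //.
- by apply: (measurableT_comp mpsi); exact: measurable_shift_rV.
- by move=> x y; apply: le_trans (psil _ _) _; rewrite opprD addrACA subrr addr0.
- move=> x xc; apply: psi0; rewrite -ltrBDr in xc; apply: lt_le_trans xc _.
  by rewrite lerBlDr -[X in `|X| <= _](addrK c) -[`|c|]normrN ler_normD.
Qed.

Lemma locbnd_weight rho l psi e : is_weight rho l psi -> locbnd e ->
  locbnd (fun x s => psi x * e x s).
Proof.
move=> [mpsi psi01 _ _] le; apply: (locbnd_le le).
  apply: measurable_funM; last exact: le.1.
  by apply: (measurableT_comp mpsi); exact: measurable_fst.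
move=> x s; rewrite normrM ler_piMl//.
by have /andP[p0 p1] := psi01 x; rewrite ger0_norm.
Qed.

Lemma supported_weight rho l psi e : is_weight rho l psi ->
  supported rho (fun x s => psi x * e x s).
Proof. by move=> [_ _ _ psi0] x s /psi0 ->; rewrite mul0r. Qed.

Lemma integrable_weight rho l psi e s : is_weight rho l psi -> locbnd e ->
  m.-integrable setT (fun x => (psi x * e x s)%:E).
Proof.
move=> wpsi le; apply: (@supported_integrable _ _ (fun x s => psi x * e x s) rho).
  exact: locbnd_weight wpsi le.
exact: (supported_weight _ wpsi).
Qed.

Lemma weight_integral_le rho l psi e s r K : is_weight rho l psi -> locbnd e ->
  rho <= r -> (\int[m]_(x in cball r) `|e x s|%:E <= K%:E)%E ->
  `|\int[m]_x (psi x * e x s)| <= K.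
Proof.
move=> wpsi le rr eK; apply: Rintegral_normr_le => //.
  exact: (integrable_weight s wpsi le).
have sw : supported r (fun x s => psi x * e x s).
  by move=> x t /(le_lt_trans rr); exact: (supported_weight _ wpsi).
rewrite (supported_integral s sw); apply: le_trans eK.
apply: ge0_le_integral => //.
- exact: measurable_cball.
- apply/measurable_funTS/measurable_EFinP/measurableT_comp => //.
  by have := locbnd_slice s (locbnd_weight wpsi le).
- apply/measurable_funTS/measurable_EFinP/measurableT_comp => //.
  by have := locbnd_slice s le.
- move=> x _; rewrite lee_fin normrM ler_piMl//.
  by have [_ /(_ x)/andP[p0 p1] _ _] := wpsi; rewrite ger0_norm.
Qed.

(** Translating by [s *: v] moves the whole displacement onto the weight: [psi] is compared with its
    shift by [(b - s) *: v], which differs by at most [l * (b - s) * |v|]. Both weights are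
    supported in the ball of radius [r]. *)
Lemma weight_transport rho l psi e (v : 'rV[R]_d) (b s K r : R) :
  is_weight rho l psi -> locbnd e -> 0 <= l -> s <= b ->
  rho + (b - s) * `|v| <= r ->
  (\int[m]_(x in cball r) `|e x s|%:E <= K%:E)%E ->
  `|\int[m]_x (psi (x + b *: v) * e (x + s *: v) s) - \int[m]_x (psi x * e x s)|
    <= l * (b - s) * `|v| * K.
Proof.
move=> wpsi le l0 sb rr eK; have bs0 : 0 <= b - s by rewrite subr_ge0.
pose psi' x := psi (x + (b - s) *: v).
have wpsi' := is_weight_shift ((b - s) *: v) wpsi.
have -> : \int[m]_x (psi (x + b *: v) * e (x + s *: v) s) =
          \int[m]_x (psi' x * e x s).
  rewrite -[RHS](@integral_shift _ _ (s *: v)).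
    by apply: eq_Rintegral => x _; rewrite /psi' -addrA -scalerDl subrKC.
  by have := locbnd_slice s (locbnd_weight wpsi' le).
rewrite -RintegralB//; [|exact: (integrable_weight s wpsi' le)|
  exact: (integrable_weight s wpsi le)].
have lF : locbnd (fun x s => psi' x * e x s - psi x * e x s).
  by apply: locbndB; [exact: (locbnd_weight wpsi' le)|exact: (locbnd_weight wpsi le)].
have sF : supported r (fun x s => psi' x * e x s - psi x * e x s).
  move=> x t rx; have xr := le_lt_trans rr rx.
  rewrite (supported_weight _ wpsi') ?normrZ ?(ger0_norm bs0)//.
  rewrite (supported_weight _ wpsi) ?subrr// (le_lt_trans _ xr)//.
  by rewrite lerDl mulr_ge0.
apply: Rintegral_normr_le => //; first exact: (supported_integrable s lF sF).
rewrite (supported_integral s sF).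
have k0 : 0 <= l * (b - s) * `|v| by rewrite !mulr_ge0.
have me : measurable_fun (cball r) (fun x => `|e x s|%:E).
  apply/measurable_funTS/measurable_EFinP/measurableT_comp => //.
  by have := locbnd_slice s le.
apply: (@le_trans _ _ (\int[m]_(x in cball r) ((l * (b - s) * `|v|)%:E * `|e x s|%:E))%E).
  apply: ge0_le_integral => //.
  - exact: measurable_cball.
  - apply/measurable_funTS/measurable_EFinP/measurableT_comp => //.
    by have := locbnd_slice s lF.
  - exact: measurable_funeM.
  - move=> x _; rewrite -EFinM lee_fin -mulrBl normrM ler_wpM2r//.
    have [_ _ /(_ (x + (b - s) *: v) x) + _] := wpsi => /le_trans; apply.
    by rewrite addrC addKr normrZ ger0_norm// mulrA.
rewrite ge0_integralZl_EFin//; last exact: measurable_cball.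
by rewrite [leRHS]EFinM lee_wpmul2l ?lee_fin.
Qed.

End weight.

(** * The entropy inequality over one time step *)

Lemma Rintegral_itv_le {R : realType} (f : R -> R) (a b K : R) : a <= b ->
  (@lebesgue_measure R).-integrable `[a, b] (EFin \o f) ->
  (forall s, a <= s <= b -> f s <= K) ->
  \int[lebesgue_measure]_(s in `[a, b]) f s <= K * (b - a).
Proof.
move=> ab fi fK.
have -> : K * (b - a) = \int[lebesgue_measure]_(s in `[a, b]) K.
  rewrite Rintegral_cst; last exact: measurable_itv.
  rewrite /= lebesgue_measure_itv/= lte_fin.
  case: ltP => //= ba; have -> : b = a by apply/eqP; rewrite eq_le ab ba.
  by rewrite subrr.
apply: le_Rintegral => //.
apply: measurable_bounded_integrable => //.
- by rewrite /= lebesgue_measure_itv/=; case: ifP => // _; rewrite -EFinB ltry.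
- exact: bounded_cst.
Qed.

Section entropy_step.
Context {R : realType} {d n : nat}.
Notation m := (@lebesgue_rV R d).
Notation lm := (@lebesgue_measure R).
Variables (v : 'I_n -> 'rV[R]_d) (mu : 'I_n -> 'I_n -> R)
  (g : 'I_n -> 'rV[R]_d -> R -> R).

(** The coupling term along the characteristic of index [i], with the symmetry of [mu] already used
    to factor out [mu i j]. *)
Definition exchange i (x : 'rV[R]_d) (s : R) : R :=
  \sum_(j < n | j != i)
    mu i j * (g j (x + s *: v i) s - g i (x + s *: v i) s).

Hypotheses (mu_ge0 : forall i j, i != j -> 0 <= mu i j)
  (mu_sym : forall i j, i != j -> mu i j = mu j i)
  (lg : forall i, locbnd (g i))
  (mild : forall i (a b : R), 0 <= a -> a <= b -> {ae m, forall x,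
    g i (x + b *: v i) b - g i (x + a *: v i) a =
    \int[lm]_(s in `[a, b]) exchange i x s}).

Let lX i j : locbnd (fun x s => g j (x + s *: v i) s).
Proof. exact: (locbnd_trans (v i) (lg j)). Qed.

Let lQ i : locbnd (exchange i).
Proof. by apply: locbnd_sum => j _; apply: locbndZ; exact: locbndB. Qed.

(** The mild equation bounds the increment of [g i] by the time integral of [|exchange|]; after
    Fubini each time contributes at most [K]. *)
Lemma weight_variation_le i (a b r rho l K : R) psi : 0 <= a -> a <= b ->
  is_weight rho l psi -> rho <= r ->
  (forall s, a <= s <= b ->
    (\int[m]_(x in cball r) `|exchange i x s|%:E <= K%:E)%E) ->
  \int[m]_x (psi x * `|g i (x + b *: v i) b - g i (x + a *: v i) a|) <= K * (b - a).
Proof.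
move=> a0 ab wpsi rr QK.
have lnQ := locbnd_norm (lQ i).
have lF := locbnd_weight wpsi lnQ.
have sF : supported rho (fun x s => psi x * `|exchange i x s|).
  exact: (supported_weight _ wpsi).
apply: (@le_trans _ _ (\int[m]_x \int[lm]_(s in `[a, b]) (psi x * `|exchange i x s|))).
  apply: ae_le_Rintegral => //.
  - apply: (@integrable_weight _ _ _ _ _ (fun x _ =>
      `|g i (x + b *: v i) b - g i (x + a *: v i) a|) 0 wpsi).
    by apply: locbnd_norm; apply: locbndB; exact: (locbnd_freeze _ (lX i i)).
  - exact: integrable_integral_itv lF sF ab.
  have mi := ae_integrable_trace (lQ i) ab.
  apply: filterS2 (mild i a0 ab) mi => x -> Qi _.
  have Qn := integrable_norm Qi.
  rewrite RintegralZl//; apply: ler_wpM2l.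
    by have [_ /(_ x)/andP[]] := wpsi.
  exact: le_normr_Rintegral.
rewrite (fubini_itv lF sF ab).
apply: Rintegral_itv_le => //; first exact: integrable_itv_integral lF sF ab.
move=> s sab; apply: le_trans (ler_norm _) _.
apply: (weight_integral_le wpsi lnQ rr).
by under eq_integral do rewrite normr_id; exact: QK.
Qed.

Variables (eta : R -> R) (L : R).
Hypotheses (L0 : 0 <= L) (eta_convex : convex_function setT eta)
  (etaL : forall x y, `|eta x - eta y| <= L * `|x - y|).

Let meta : measurable_fun [set: R] eta := lipschitz_measurable etaL.

(** The exchange term for [eta] plus the price [2 L |X b - X s|] of freezing the subgradient at the
    final time [b]. *)
Definition eta_exchange i (b : R) (x : 'rV[R]_d) (s : R) : R :=
  \sum_(j < n | j != i)
    mu i j * (eta (g j (x + s *: v i) s) - eta (g i (x + s *: v i) s) +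
      2 * L * `|g i (x + b *: v i) b - g i (x + s *: v i) s|).

Let lE i j : locbnd (fun x s => eta (g j (x + s *: v i) s)).
Proof. exact: (locbnd_comp meta etaL (lX i j)). Qed.

Let lD i b : locbnd (fun x s => `|g i (x + b *: v i) b - g i (x + s *: v i) s|).
Proof.
apply: locbnd_norm; apply: locbndB; last exact: lX.
exact: (locbnd_freeze b (lX i i)).
Qed.

Let lH i b : locbnd (eta_exchange i b).
Proof.
apply: locbnd_sum => j _; apply: locbndZ; apply: locbndD; last exact: locbndZ.
exact: locbndB.
Qed.

(* Convexity is used at the final time of the step: with [p] a subgradient of
   [eta] at [X b], [p * (Y - X s) <= eta Y - eta (X s) + 2 L |X b - X s|]. *)
Lemma entropy_characteristic i (a b : R) : 0 <= a -> a <= b ->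
  {ae m, forall x,
    eta (g i (x + b *: v i) b) - eta (g i (x + a *: v i) a) <=
    \int[lm]_(s in `[a, b]) eta_exchange i b x s}.
Proof.
move=> a0 ab.
apply: filterS3 (mild i a0 ab) (ae_integrable_trace (lQ i) ab)
  (ae_integrable_trace (lH i b) ab) => x X Qi Hi.
have [p pL sub] := convex_subgradient eta_convex etaL (g i (x + b *: v i) b).
(* The slope [p] depends on [x] but not on [s], so it passes through the time integral of the mild
   equation. *)
apply: (@le_trans _ _ (\int[lm]_(s in `[a, b]) (p * exchange i x s))).
  rewrite RintegralZl// -X.
  have := sub (g i (x + a *: v i) a); lra.
apply: le_Rintegral => //.
  have mab : measurable (`[a, b]%classic : set (measurableTypeR R)).
    exact: measurable_itv.
  have := integrableZl mab p Qi.
  by apply: eq_integrable => //= s _; rewrite EFinM.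
move=> s _; rewrite /exchange mulr_sumr; apply: ler_sum => j ji.
rewrite mulrCA ler_wpM2l ?mu_ge0 1?eq_sym//.
set Y := g j _ _; set Xb := g i (x + b *: v i) b; set Xs := g i (x + s *: v i) s.
(* Passing through [Xb] costs [L |Xb - Xs|] twice: once for [p * (Xb - Xs)], once for replacing
   [eta Xb] by [eta Xs]. *)
have h1 := sub Y; have h2 := etaL Xs Xb; rewrite -/Xb in h1.
have h3 : p * (Xb - Xs) <= L * `|Xb - Xs|.
  by rewrite (le_trans (ler_norm _))// normrM ler_wpM2r.
rewrite (distrC Xs) in h2.
have {h2} : eta Xs - eta Xb <= L * `|Xb - Xs| by rewrite (le_trans (ler_norm _)).
move: h1 h3; set A := L * `|Xb - Xs|.
have -> : 2 * L * `|Xb - Xs| = 2 * A by rewrite /A; ring.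
nra.
Qed.

(** Gains and losses coincide after the two indices are exchanged, because [mu] is symmetric. *)
Lemma exchange_sum0 (B : 'I_n -> R) :
  \sum_i \sum_(j < n | j != i) mu i j * (B j - B i) = 0.
Proof.
under eq_bigr do under eq_bigr do rewrite mulrBr.
under eq_bigr do rewrite sumrB.
rewrite sumrB; apply/eqP; rewrite subr_eq0; apply/eqP.
rewrite (exchange_big_dep xpredT)//=; apply: eq_bigr => i _.
by apply: eq_big => [j|j ij]; [rewrite eq_sym|rewrite (mu_sym ij)].
Qed.

(** The constant [C] is chosen before the weight and the step, so the quadratic errors of many short
    steps add up to something small. Only the transport of the weight is left at first order. *)
Lemma entropy_step (rho l T : R) : 0 <= rho -> 0 <= l -> 0 <= T ->
  exists C : R, forall psi a b, is_weight rho l psi -> 0 <= a -> a <= b -> b <= T ->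
    \sum_i \int[m]_x (psi x * eta (g i x b)) <=
    \sum_i \int[m]_x (psi (x + (b - a) *: v i) * eta (g i x a)) +
      C * (b - a) ^+ 2.
Proof.
move=> rho0 l0 T0.
(* The ball must contain the supports of all weights transported up to time [T]; the last summand
   [T] makes [r] a bound for the times too. *)
pose V := \sum_i `|v i|; pose r := rho + T * V + T.
have V0 : 0 <= V by exact: sumr_ge0.
have vV i : `|v i| <= V by rewrite /V (bigD1 i)//= lerDl sumr_ge0.
have leta j : locbnd (fun x s => eta (g j x s)) by exact: (locbnd_comp meta etaL (lg j)).
have [K1 K10 eK1] := locbnd_unif r leta.
have [K2 K20 QK2] := locbnd_unif r lQ.
(* Two transport errors, for [eta (g j)] and [eta (g i)], plus [2 L] times the drift of [g i]. *)
pose c := 2 * (l * V * K1) + 2 * L * K2.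
pose C i := \sum_(j < n | j != i) mu i j * c.
exists (\sum_i C i) => psi a b wpsi a0 ab bT.
have b0 := le_trans a0 ab.
have bT' (i : 'I_n) s : 0 <= s -> s <= T -> s * `|v i| <= T * V.
  by move=> s0 sT; rewrite ler_pM.
have sr s : a <= s <= b -> `|s| <= r.
  move=> /andP[as_ sb]; rewrite ger0_norm ?(le_trans a0)// /r.
  by rewrite (le_trans sb)// (le_trans bT)// lerDr addr_ge0// mulr_ge0.
pose w i x := psi (x + b *: v i).
have ww i : is_weight (rho + T * V) l (w i).
  have [? ? ? w0] := is_weight_shift (b *: v i) wpsi; split=> // x rx; apply: w0.
  by apply: le_lt_trans rx; rewrite lerD2l normrZ ger0_norm// bT'.
have rr : rho + T * V <= r by rewrite /r lerDl.
pose J j s := \int[m]_x (psi x * eta (g j x s)).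
have iJ j : lm.-integrable `[a, b] (fun s => (J j s)%:E).
  exact: (integrable_itv_integral (locbnd_weight wpsi (leta j))
    (supported_weight _ wpsi) ab).
pose B j := \int[lm]_(s in `[a, b]) J j s.
(* The inequality is proved for each [i] with the exchange terms kept; these vanish in the sum over
   [i] by [exchange_sum0]. *)
suff key i : \int[m]_x (psi x * eta (g i x b)) -
      \int[m]_x (psi (x + (b - a) *: v i) * eta (g i x a)) <=
    \sum_(j < n | j != i) mu i j * (B j - B i) + C i * (b - a) ^+ 2.
  rewrite -lerBlDl -sumrB; apply: le_trans (ler_sum _ (fun i _ => key i)) _.
  by rewrite big_split/= exchange_sum0 add0r mulr_suml.
have mg := locbnd_slice _ (leta i).
have mwpsi s : measurable_fun setT (fun x => psi x * eta (g i x s)).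
  by have := locbnd_slice s (locbnd_weight wpsi (leta i)).
(* Translations by [b *: v i] and [a *: v i] bring both integrals to the characteristic of index
   [i], where they carry the same weight [w i]. *)
rewrite -(integral_shift (b *: v i) (mwpsi b)).
rewrite -(integral_shift (a *: v i) (_ : measurable_fun setT
    (fun x : 'rV[R]_d => psi (x + (b - a) *: v i) * eta (g i x a)))); last first.
  have := locbnd_slice a (locbnd_weight (is_weight_shift ((b - a) *: v i) wpsi) (leta i)).
  exact.
under [X in _ - X <= _]eq_Rintegral do rewrite -addrA -scalerDl subrKC.
have ilX s : m.-integrable setT (fun x => (w i x * eta (g i (x + s *: v i) s))%:E).
  exact: (integrable_weight s (ww i) (lE i i)).
rewrite -RintegralB//; [|exact: ilX|exact: ilX].
have lF := locbnd_weight (ww i) (lH i b).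
have sF : supported (rho + T * V) (fun x s => w i x * eta_exchange i b x s).
  exact: (supported_weight _ (ww i)).
apply: (@le_trans _ _ (\int[m]_x \int[lm]_(s in `[a, b]) (w i x * eta_exchange i b x s))).
  apply: ae_le_Rintegral => //.
  - exact: (integrableB_EFin measurableT (ilX b) (ilX a)).
  - exact: integrable_integral_itv lF sF ab.
  apply: filterS2 (entropy_characteristic i a0 ab) (ae_integrable_trace (lH i b) ab).
  move=> x ent Hi _; rewrite RintegralZl// -mulrBr; apply: ler_wpM2l => //.
  by have [_ /(_ x)/andP[]] := ww i.
rewrite (fubini_itv lF sF ab).
have iF := integrable_itv_integral lF sF ab.
have mab : measurable (`[a, b]%classic : set (measurableTypeR R)).
  exact: measurable_itv.
have iJB j := integrableB_EFin mab (iJ j) (iJ i).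
have iS : lm.-integrable `[a, b]
    (fun s => (\sum_(j < n | j != i) mu i j * (J j s - J i s))%:E).
  by apply: integrable_sum_EFin => // j _; exact: (integrableZ_EFin mab (mu i j) (iJB j)).
have -> : \sum_(j < n | j != i) mu i j * (B j - B i) =
    \int[lm]_(s in `[a, b]) \sum_(j < n | j != i) mu i j * (J j s - J i s).
  rewrite Rintegral_sum//; last first.
    by move=> j _; exact: (integrableZ_EFin mab (mu i j) (iJB j)).
  apply: eq_bigr => j _; rewrite RintegralZl//; last exact: iJB.
  by rewrite RintegralB//; exact: iJ.
rewrite -lerBlDl -RintegralB//.
(* It remains to bound the integrand by [C i * (b - a)] at each time; the other factor [b - a] is
   the length of the interval. *)
rewrite expr2 mulrA; apply: Rintegral_itv_le => //.
  exact: (integrableB_EFin mab iF iS).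
move=> s sab; have /andP[as_ sb] := sab.
have s0 := le_trans a0 as_; have sT := le_trans sb bT.
pose D x s := `|g i (x + b *: v i) b - g i (x + s *: v i) s|.
have -> : \int[m]_x (w i x * eta_exchange i b x s) =
   \sum_(j < n | j != i) mu i j *
     (\int[m]_x (w i x * eta (g j (x + s *: v i) s)) -
      \int[m]_x (w i x * eta (g i (x + s *: v i) s)) +
      2 * L * \int[m]_x (w i x * D x s)).
  have iE j : m.-integrable setT (fun x => (w i x * eta (g j (x + s *: v i) s))%:E).
    exact: (integrable_weight s (ww i) (lE i j)).
  have iD : m.-integrable setT (fun x => (w i x * D x s)%:E).
    exact: (integrable_weight s (ww i) (lD i b)).
  have iDZ := integrableZ_EFin measurableT (2 * L) iD.
  have iEB j := integrableB_EFin measurableT (iE j) (iE i).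
  transitivity (\int[m]_x (\sum_(j < n | j != i) mu i j *
     ((w i x * eta (g j (x + s *: v i) s) - w i x * eta (g i (x + s *: v i) s)) +
       2 * L * (w i x * D x s)))).
    apply: eq_Rintegral => x _; rewrite mulr_sumr; apply: eq_bigr => j _.
    by rewrite /D; ring.
  have iEBD j := integrableD_EFin measurableT (iEB j) iDZ.
  rewrite Rintegral_sum//; last first.
    by move=> j _; exact: (integrableZ_EFin measurableT (mu i j) (iEBD j)).
  apply: eq_bigr => j _.
  rewrite (RintegralZl _ measurableT (iEBD j)).
  rewrite (RintegralD measurableT (iEB j) iDZ).
  by rewrite (RintegralB measurableT (iE j) (iE i)) (RintegralZl _ measurableT iD).
rewrite -sumrB /C mulr_suml; apply: ler_sum => j ji.
rewrite -[leLHS]mulrBr -[leRHS]mulrA; apply: ler_wpM2l.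
  by rewrite mu_ge0// eq_sym.
(* Replacing the integral along the characteristic by [J k s], which is independent of [i], costs
   the variation of the weight over a time [b - s]. *)
have tr k : `|\int[m]_x (w i x * eta (g k (x + s *: v i) s)) - J k s| <=
    l * V * K1 * (b - a).
  have bs0 : 0 <= b - s by rewrite subr_ge0.
  apply: (@le_trans _ _ (l * (b - s) * `|v i| * K1)).
    apply: (weight_transport (r := r) wpsi (leta k)) => //; last exact: eK1 (sr _ sab).
    apply: le_trans rr; rewrite lerD2l bT'// lerBlDl (le_trans bT)// lerDr.
    exact: s0.
  have bsv : (b - s) * `|v i| <= (b - a) * V by rewrite ler_pM// lerD2l lerN2.
  rewrite [leLHS](_ : _ = l * K1 * ((b - s) * `|v i|)); last by ring.
  rewrite [leRHS](_ : _ = l * K1 * ((b - a) * V)); last by ring.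
  by rewrite ler_wpM2l// mulr_ge0.
(* The drift of [g i] from [s] to [b] is governed by the exchange term, hence also [O(b - a)]. *)
have vr : \int[m]_x (w i x * D x s) <= K2 * (b - a).
  apply: (@le_trans _ _ (K2 * (b - s))); last by rewrite ler_wpM2l// lerD2l lerN2.
  apply: (weight_variation_le s0 sb (ww i) rr) => t /andP[st tb]; apply: QK2.
  by apply: sr; rewrite tb (le_trans as_).
have := tr j; have := tr i; rewrite !ler_norml => /andP[+ _] /andP[_ +].
have : 2 * L * \int[m]_x (w i x * D x s) <= 2 * L * (K2 * (b - a)).
  by rewrite ler_wpM2l// mulr_ge0.
rewrite [c * _](_ : _ = 2 * (l * V * K1 * (b - a)) + 2 * L * (K2 * (b - a))).
  lra.
by rewrite /c; ring.
Qed.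

End entropy_step.

(** * Cutoffs *)

Section cutoff.
Context {R : realType} {d : nat}.
Implicit Types (r c u w : R) (x y : 'rV[R]_d).

Definition clamp01 u : R := Num.max 0 (Num.min 1 u).

Lemma clamp01_ge0_le1 u : 0 <= clamp01 u <= 1.
Proof. by rewrite /clamp01 le_max lexx/= ge_max ler01 ge_min lexx. Qed.

Lemma clamp01_le u w : u <= w -> clamp01 u <= clamp01 w.
Proof.
move=> uw; rewrite /clamp01 ge_max !le_max lexx/=.
by rewrite le_min !ge_min lexx uw !orbT.
Qed.

Lemma clamp01_leD u w : 0 <= w -> clamp01 (u + w) <= clamp01 u + w.
Proof.
by move=> w0; rewrite /clamp01; case: (leP 1 (u + w)); case: (leP 1 u);
  case: (leP 0 u); case: (leP 0 (u + w)) => *; rewrite ?maxEle ?minEle;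
  do ?[case: ifP => /= ?]; lra.
Qed.

Lemma clamp01_lip u w : `|clamp01 u - clamp01 w| <= `|u - w|.
Proof.
wlog uw : u w / w <= u.
  move=> h; have [/ltW|] := ltP u w; last exact: h.
  by move=> uw; rewrite distrC [leRHS]distrC; exact: h.
rewrite !ger0_norm ?subr_ge0//; last exact: clamp01_le.
rewrite lerBlDl; have := @clamp01_leD w (u - w).
by rewrite subr_ge0 subrKC; apply.
Qed.

Lemma clamp01_eq0 u : u <= 0 -> clamp01 u = 0.
Proof. by move=> u0; rewrite /clamp01 min_r ?(le_trans u0)// max_l. Qed.

Lemma clamp01_eq1 u : 1 <= u -> clamp01 u = 1.
Proof. by move=> u1; rewrite /clamp01 min_l// max_r. Qed.

(** For [r > 0] this is 1 when [|x| <= r + c], 0 when [|x| >= 2 r + c], and affine in [|x|] with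
    slope [-1/r] in between. The offset [c] will vary with time. *)
Definition cutoff r c x : R := clamp01 (2 - (`|x| - c) / r).

(** The upper bound [c0] gives one support radius for all the offsets met on a time interval. *)
Lemma cutoff_weight r c c0 : 0 < r -> c <= c0 ->
  is_weight (2 * r + c0) r^-1 (@cutoff r c).
Proof.
move=> r0 cc0; split.
- have := @measurable_norm_rV R d => mn.
  apply: measurable_maxr => //; apply: measurable_minr => //.
  apply: measurable_funB => //; apply: measurable_funM => //.
  exact: measurable_funB.
- by move=> x; exact: clamp01_ge0_le1.
- move=> x y; apply: le_trans (clamp01_lip _ _) _.
  have -> : 2 - (`|x| - c) / r - (2 - (`|y| - c) / r) = - (r^-1 * (`|x| - `|y|)).
    by ring.
  rewrite normrN normrM ger0_norm ?invr_ge0 ?(ltW r0)// ler_wpM2l ?invr_ge0 ?(ltW r0)//.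
  exact: ler_dist_dist.
- move=> x rx; apply: clamp01_eq0; rewrite subr_le0 ler_pdivlMr// lerBrDr.
  by rewrite (le_trans _ (ltW rx))// lerD2l.
Qed.

Lemma cutoff_le r c c' x y : 0 < r -> `|y| - c' <= `|x| - c ->
  cutoff r c x <= cutoff r c' y.
Proof.
by move=> r0 h; apply: clamp01_le; rewrite lerD2l lerN2 ler_pM2r ?invr_gt0.
Qed.

Lemma cutoff_leD r c c' x y k : 0 < r -> 0 <= k ->
  `|x| - c <= `|y| - c' + k -> cutoff r c' y <= cutoff r c x + k / r.
Proof.
move=> r0 k0 h; apply: le_trans _ (clamp01_leD _ _); last by rewrite divr_ge0// ltW.
apply: clamp01_le; rewrite [leRHS](_ : _ = 2 - (`|x| - c - k) / r); last by ring.
by rewrite lerD2l lerN2 ler_pM2r ?invr_gt0// lerBlDr.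
Qed.

Lemma cutoff_eq1 r c x : 0 < r -> `|x| - c <= r -> cutoff r c x = 1.
Proof.
move=> r0 h; apply: clamp01_eq1.
have : (`|x| - c) / r <= 1 by rewrite ler_pdivrMr// mul1r.
lra.
Qed.

(** Dominated convergence with majorant [|u|]: at each point the cutoffs are eventually equal to
    1. *)
Lemma cutoff_integral_cvg (u : 'rV[R]_d -> R) c :
  (lebesgue_rV d).-integrable setT (EFin \o u) ->
  \int[lebesgue_rV d]_x (cutoff k.+1%:R c x * u x) @[k --> \oo] -->
  \int[lebesgue_rV d]_x u x.
Proof.
move=> iu; have mu := measurable_int _ iu.
apply: fine_cvg; rewrite fineK; last exact: integrable_fin_num.
apply: (@dominated_cvg _ _ _ _ _ measurableT _ _ (fun x => `|u x|%:E)) => //.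
- move=> k; apply/measurable_EFinP; apply: measurable_funM.
    by have [] := @cutoff_weight k.+1%:R c c (ltr0Sn _ _) (lexx c).
  exact/measurable_EFinP.
- move=> x _; apply: cvg_near_cst.
  near=> k; congr EFin; rewrite cutoff_eq1 ?mul1r//.
  apply: (@le_trans _ _ k%:R); last by rewrite ler_nat.
  by near: k; exact: nbhs_infty_ger.
- exact: (integrable_norm iu).
- move=> k x _; rewrite lee_fin normrM ler_piMl//.
  by have /andP[? ?] := clamp01_ge0_le1 (2 - (`|x| - c) / k.+1%:R); rewrite ger0_norm.
Unshelve. all: by end_near. Qed.

End cutoff.

(** * Propagation *)

Lemma le_of_le_divn {R : realType} (x y c : R) :
  (forall N : nat, x <= y + c / N.+1%:R) -> x <= y.
Proof.
move=> h; rewrite leNgt; apply/negP => yx.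
have d0 : 0 < x - y by rewrite subr_gt0.
have [N Nc] : exists N : nat, `|c| / (x - y) < N.+1%:R.
  by exists (Num.trunc (`|c| / (x - y))); exact: truncnS_gt.
have := h N; rewrite leNgt => /negP; apply.
rewrite -ltrBrDl ltr_pdivrMr// mulrC (le_lt_trans (ler_norm c))//.
by rewrite -ltr_pdivrMr.
Qed.

Section propagation.
Context {R : realType} {d n : nat}.
Notation m := (@lebesgue_rV R d).
Notation lm := (@lebesgue_measure R).
Variables (v : 'I_n -> 'rV[R]_d) (mu : 'I_n -> 'I_n -> R)
  (g : 'I_n -> 'rV[R]_d -> R -> R).
Hypotheses (mu_ge0 : forall i j, i != j -> 0 <= mu i j)
  (mu_sym : forall i j, i != j -> mu i j = mu j i)
  (lg : forall i, locbnd (g i))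
  (mild : forall i (a b : R), 0 <= a -> a <= b -> {ae m, forall x,
    g i (x + b *: v i) b - g i (x + a *: v i) a =
    \int[lm]_(s in `[a, b]) exchange v mu g i x s}).

Definition weighted_entropy (eta : R -> R) (psi : 'rV[R]_d -> R) t : R :=
  \sum_i \int[m]_x (psi x * eta (g i x t)).

(** Stands in for the maximal speed: it bounds every [|v i|]. *)
Definition total_speed : R := \sum_i `|v i|.
Let V := total_speed.

Let V0 : 0 <= V. Proof. exact: sumr_ge0. Qed.

Let vV i : `|v i| <= V.
Proof. by rewrite /V /total_speed (bigD1 i)//= lerDl sumr_ge0. Qed.

Let norm_char h i (x : 'rV[R]_d) : 0 <= h ->
  `|x| - h * V <= `|x + h *: v i| <= `|x| + h * V.
Proof.
move=> h0; have hv : `|h *: v i| <= h * V by rewrite normrZ ger0_norm// ler_wpM2l.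
rewrite (le_trans (ler_normD _ _)) ?lerD2l// andbT.
have := ler_normB (x + h *: v i) (h *: v i); rewrite addrK; lra.
Qed.

Let weight_cutoff r t t2 (k : R) : 0 < r -> 0 <= t -> t <= t2 -> `|k| <= 1 ->
  is_weight (2 * r + t2 * V) r^-1 (@cutoff R d r (k * (t * V))).
Proof.
move=> r0 t0 tt2 k1; apply: cutoff_weight => //.
rewrite (le_trans (ler_norm _))// normrM [`|t * V|]ger0_norm ?mulr_ge0//.
apply: (@le_trans _ _ (t * V)); first by rewrite ler_piMl// mulr_ge0.
by rewrite ler_wpM2r.
Qed.

(** * Iteration of time steps, and the whole-space inequality for nonnegative entropies *)

Section fixed_entropy.
Variables (eta : R -> R) (L : R).
Hypotheses (L0 : 0 <= L) (eta_convex : convex_function setT eta)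
  (etaL : forall x y, `|eta x - eta y| <= L * `|x - y|).

Notation S := (weighted_entropy eta).

(** The interval is cut into [N + 1] steps of length [h]. A step costs [e * h] for the motion of the
    weight and [C * h ^+ 2] from [entropy_step]; in total [e * (t2 - t1)] plus a remainder of order
    [1 / (N + 1)]. *)
Lemma entropy_propagation (rho l t1 t2 e : R) (psi : R -> 'rV[R]_d -> R) :
  0 <= rho -> 0 <= l -> 0 <= t1 -> t1 <= t2 ->
  (forall t, t1 <= t <= t2 -> is_weight rho l (psi t)) ->
  (forall t h, t1 <= t -> 0 <= h -> t + h <= t2 ->
    \sum_i \int[m]_x (psi (t + h) (x + h *: v i) * eta (g i x t)) <=
    S (psi t) t + e * h) ->
  S (psi t2) t2 <= S (psi t1) t1 + e * (t2 - t1).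
Proof.
move=> rho0 l0 t10 t12 wpsi psile.
have t20 := le_trans t10 t12.
have [C step] := entropy_step mu_ge0 mu_sym lg mild L0 eta_convex etaL rho0 l0 t20.
apply: (@le_of_le_divn _ _ _ (C * (t2 - t1) ^+ 2)) => N.
pose h := (t2 - t1) / N.+1%:R.
have N0 : 0 < N.+1%:R :> R by [].
have h0 : 0 <= h by rewrite divr_ge0// subr_ge0.
have hN : t1 + N.+1%:R * h = t2 by rewrite /h mulrC divfK ?gt_eqF// subrKC.
suff iter k : (k <= N.+1)%N ->
    S (psi (t1 + k%:R * h)) (t1 + k%:R * h) <=
    S (psi t1) t1 + k%:R * (e * h + C * h ^+ 2).
  have := iter N.+1 (leqnn _); rewrite hN => /le_trans; apply.
  rewrite -addrA lerD2l le_eqVlt; apply/orP; left; apply/eqP.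
  by rewrite /h; field; rewrite gt_eqF.
elim: k => [_|k IH kN]; first by rewrite !mul0r !addr0.
have {}IH := IH (ltnW kN); pose t := t1 + k%:R * h.
have tE : t1 + k.+1%:R * h = t + h by rewrite /t -natr1; ring.
have t1t : t1 <= t by rewrite lerDl mulr_ge0.
have tht2 : t + h <= t2 by rewrite -tE -hN lerD2l ler_wpM2r// ler_nat.
have th : t <= t + h by rewrite lerDl.
rewrite tE; apply: (le_trans (step (psi (t + h)) t (t + h) _ _ th tht2)).
- by apply: wpsi; rewrite tht2 (le_trans t1t).
- exact: le_trans t1t.
rewrite (_ : t + h - t = h); last by ring.
have := psile t h t1t h0 tht2; move: IH.
have -> : k.+1%:R * (e * h + C * h ^+ 2) =
    k%:R * (e * h + C * h ^+ 2) + (e * h + C * h ^+ 2) by rewrite -natr1; ring.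
rewrite -/t; lra.
Qed.

Let leta i : locbnd (fun x s => eta (g i x s)).
Proof. exact: (locbnd_comp (lipschitz_measurable etaL) etaL (lg i)). Qed.

(** The cutoff radius shrinks at speed [total_speed], so the weight does not increase along any
    characteristic, and the propagation rate is [e = 0] since [eta >= 0]. *)
Lemma entropy_cutoff_ge0 r t1 t2 : (forall u, 0 <= eta u) -> 0 < r ->
  0 <= t1 -> t1 <= t2 ->
  S (cutoff r (- (t2 * total_speed))) t2 <=
  S (cutoff r (- (t1 * total_speed))) t1.
Proof.
move=> eta0 r0 t10 t12; have t20 := le_trans t10 t12.
have wt t : 0 <= t -> t <= t2 ->
    is_weight (2 * r + t2 * V) r^-1 (@cutoff R d r (- (t * V))).
  move=> t0 tt2; rewrite -mulN1r; apply: weight_cutoff => //.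
  by rewrite normrN1.
rewrite -[leRHS]addr0 -(mul0r (t2 - t1)).
apply: (entropy_propagation (rho := 2 * r + t2 * V) (l := r^-1)
  (psi := fun t => cutoff r (- (t * V)))) => //.
- by rewrite addr_ge0// ?mulr_ge0// ltW.
- by rewrite invr_ge0 ltW.
- by move=> t /andP[t1t tt2]; apply: wt => //; exact: le_trans t1t.
move=> t h t1t h0 tht2; rewrite mul0r addr0; apply: ler_sum => i _.
have t0 := le_trans t10 t1t; have tt2 : t <= t2 by rewrite (le_trans _ tht2)// lerDl.
have w1 := wt t t0 tt2.
have w2 := is_weight_shift (h *: v i) (wt (t + h) (addr_ge0 t0 h0) tht2).
apply: le_Rintegral => //.
- exact: (integrable_weight t w2 (leta i)).
- exact: (integrable_weight t w1 (leta i)).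
- move=> x _; apply: ler_wpM2r => //; apply: cutoff_le => //.
  by have /andP[+ _] := norm_char i x h0; rewrite mulrDl; lra.
Qed.

(** Monotone convergence over balls of radius [k]. The inequality is stated in the extended reals
    because finiteness at [t2] is one of its consequences. *)
Lemma entropy_integral_ge0 t1 t2 : (forall u, 0 <= eta u) ->
  0 <= t1 -> t1 <= t2 ->
  (forall i, m.-integrable setT (fun x => (eta (g i x t1))%:E)) ->
  (\sum_i \int[m]_x (eta (g i x t2))%:E <=
   \sum_i \int[m]_x (eta (g i x t1))%:E)%E.
Proof.
move=> eta0 t10 t12 i1; have t20 := le_trans t10 t12.
pose A := \sum_i \int[m]_x eta (g i x t1).
have -> : (\sum_i \int[m]_x (eta (g i x t1))%:E = A%:E)%E.
  rewrite /A -sumEFin; apply: eq_bigr => i _.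
  by rewrite /Rintegral fineK//; exact: integrable_fin_num.
have meta i : measurable_fun setT (fun x => eta (g i x t2)).
  by have := locbnd_slice t2 (leta i).
rewrite -ge0_integral_sum//; last 2 first.
  by move=> i; exact/measurable_EFinP.
  by move=> i x _; rewrite lee_fin.
pose F (k : nat) : set 'rV[R]_d := cball k%:R.
have FT : \bigcup_k F k = setT.
  apply/seteqP; split => // x _; exists (Num.trunc `|x|).+1 => //.
  by rewrite /F /cball/= ltW// truncnS_gt.
have mS : measurable_fun setT (fun x => (\sum_i (eta (g i x t2))%:E)%E).
  by apply: emeasurable_sum => i; exact/measurable_EFinP.
have S0 x : (0 <= \sum_i (eta (g i x t2))%:E)%E.
  by apply: sume_ge0 => i _; rewrite lee_fin.
have ndF : nondecreasing_seq F.
  by move=> k k' kk'; apply/subsetPset/subset_cball; rewrite ler_nat.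
have Fcvg := ge0_nondecreasing_set_cvg_integral (mu := m) ndF
  (fun k => measurable_cball _) (fun k => measurable_funTS mS) (fun k x _ => S0 x).
rewrite -FT -(cvg_lim _ Fcvg)//; apply: lime_le.
  by apply/cvg_ex; eexists; exact: Fcvg.
apply: nearW => k.
(* Large enough for the cutoff at time [t2] to equal 1 on the ball of radius [k]; the summand 1
   makes [r] positive. *)
pose r := k%:R + t2 * V + 1.
have tV0 : 0 <= t2 * V by exact: mulr_ge0.
have r0 : 0 < r by rewrite ltr_wpDl// addr_ge0.
have wt : is_weight (2 * r + t2 * V) r^-1 (@cutoff R d r (- (t2 * V))).
  by rewrite -mulN1r; apply: weight_cutoff => //; rewrite normrN1.
have wt1 : is_weight (2 * r + t2 * V) r^-1 (@cutoff R d r (- (t1 * V))).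
  by rewrite -mulN1r; apply: weight_cutoff => //; rewrite normrN1.
have iw i := integrable_weight t2 wt (leta i).
apply: (@le_trans _ _ (S (cutoff r (- (t2 * V))) t2)%:E).
  rewrite /weighted_entropy -sumEFin.
  rewrite ge0_integral_sum//; last 3 first.
    exact: measurable_cball.
    by move=> i; apply/measurable_funTS/measurable_EFinP.
    by move=> i x _; rewrite lee_fin.
  apply: lee_sum => i _; rewrite /Rintegral fineK; last exact: integrable_fin_num.
  rewrite integral_mkcond; apply: ge0_le_integral => //.
  - by move=> x _; apply: erestrict_ge0 => y _; rewrite lee_fin.
  - apply/(measurable_restrictT _ _).1; first exact: measurable_cball.
    exact/measurable_funTS/measurable_EFinP.
  - exact: measurable_int (iw i).
  - move=> x _; rewrite patchE; case: ifPn => [|_].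
      rewrite inE /F /cball/= => xk; rewrite cutoff_eq1 ?mul1r//.
      by rewrite opprK /r; lra.
    rewrite lee_fin mulr_ge0//.
    by have /andP[] := clamp01_ge0_le1 (2 - (`|x| - (- (t2 * V))) / r).
rewrite lee_fin (le_trans (entropy_cutoff_ge0 eta0 r0 t10 t12))//.
apply: ler_sum => i _; apply: le_Rintegral => //.
- exact: (integrable_weight t1 wt1 (leta i)).
- exact: i1.
move=> x _; rewrite ler_piMl//.
by have /andP[] := clamp01_ge0_le1 (2 - (`|x| - (- (t1 * V))) / r).
Qed.

End fixed_entropy.

(** * Entropies of arbitrary sign, by way of their positive part *)

Variables (eta : R -> R) (L : R).
Hypotheses (L0 : 0 <= L) (eta_convex : convex_function setT eta)
  (etaL : forall x y, `|eta x - eta y| <= L * `|x - y|).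

Let etap u := Num.max (eta u) 0.

Let etap_ge0 u : 0 <= etap u. Proof. by rewrite le_max lexx orbT. Qed.

Let etap_convex : convex_function setT etap.
Proof.
move=> t x y _ _; have h := eta_convex t (mem_set (I : setT x)) (mem_set (I : setT y)).
have t0 : 0 <= t%:inum by []; have t1 : 0 <= 1 - t%:inum by rewrite subr_ge0.
rewrite /etap ge_max; apply/andP; split.
  apply: le_trans h _; rewrite !convRE.
  by rewrite lerD// ler_wpM2l// le_max lexx.
rewrite convRE; apply: addr_ge0; apply: mulr_ge0 => //; exact: etap_ge0.
Qed.

Let etapL x y : `|etap x - etap y| <= L * `|x - y|.
Proof.
apply: le_trans (etaL x y); rewrite /etap.
case: (leP (eta x) 0) => ?; case: (leP (eta y) 0) => ?.
- by rewrite subrr normr0.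
- by rewrite sub0r normrN gtr0_norm// distrC (le_trans _ (ler_norm _))//; lra.
- by rewrite subr0 gtr0_norm// (le_trans _ (ler_norm _))//; lra.
- by [].
Qed.

(** The positive part of [eta] is again convex and [L]-Lipschitz, so the nonnegative case applies to
    it; each integral at [t2] is then bounded by a finite sum. *)
Lemma entropy_pos_part t1 t2 : 0 <= t1 -> t1 <= t2 ->
  (forall i, m.-integrable setT (fun x => (eta (g i x t1))%:E)) ->
  (forall i, m.-integrable setT (fun x => (Num.max (eta (g i x t2)) 0)%:E)) /\
  \sum_i \int[m]_x Num.max (eta (g i x t2)) 0 <=
  \sum_i \int[m]_x Num.max (eta (g i x t1)) 0.
Proof.
move=> t10 t12 i1; have mp t i : measurable_fun setT (fun x => etap (g i x t)).
  by have := locbnd_slice t (locbnd_comp (lipschitz_measurable etapL) etapL (lg i)).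
have ip1 i : m.-integrable setT (fun x => (etap (g i x t1))%:E).
  apply: le_integrable (i1 i) => //; first exact/measurable_EFinP.
  move=> x _; rewrite lee_fin ger0_norm// /etap ge_max normr_ge0 andbT.
  exact: ler_norm.
have E t : (forall i, m.-integrable setT (fun x => (etap (g i x t))%:E)) ->
  (\sum_i \int[m]_x (etap (g i x t))%:E = (\sum_i \int[m]_x etap (g i x t))%:E)%E.
  move=> it; rewrite -sumEFin; apply: eq_bigr => i _.
  by rewrite /Rintegral fineK//; exact: integrable_fin_num.
have le12 := entropy_integral_ge0 L0 etap_convex etapL etap_ge0 t10 t12 ip1.
have ip2 i : m.-integrable setT (fun x => (etap (g i x t2))%:E).
  apply/integrableP; split; first exact/measurable_EFinP.
  rewrite (E t1 ip1) in le12; apply: (le_lt_trans (le_trans _ le12) (ltry _)).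
  rewrite [leRHS](bigD1 i)//=.
  under eq_integral do rewrite ger0_norm//.
  rewrite leeDl//; apply: sume_ge0 => j _; apply: integral_ge0 => x _.
  by rewrite lee_fin.
by split=> //; move: le12; rewrite !E// lee_fin.
Qed.

(** The cutoff radius now grows at speed [total_speed]. Along a characteristic the weight rises by
    at most [2 h V / r] in time [h]: [h V] from the radius and [h V] from the motion of the point.
    The cost is charged to the positive part of [eta], whose integral never exceeds its value at
    [t1]. *)
Lemma entropy_cutoff_le r t1 t2 : 0 < r -> 0 <= t1 -> t1 <= t2 ->
  (forall i, m.-integrable setT (fun x => (eta (g i x t1))%:E)) ->
  weighted_entropy eta (cutoff r (t2 * V)) t2 <=
  weighted_entropy eta (cutoff r (t1 * V)) t1 +
    2 * V / r * (\sum_i \int[m]_x Num.max (eta (g i x t1)) 0) * (t2 - t1).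
Proof.
move=> r0 t10 t12 i1; have t20 := le_trans t10 t12.
have leta i : locbnd (fun x s => eta (g i x s)).
  exact: (locbnd_comp (lipschitz_measurable etaL) etaL (lg i)).
have wt t : 0 <= t -> t <= t2 ->
    is_weight (2 * r + t2 * V) r^-1 (@cutoff R d r (t * V)).
  move=> t0 tt2; rewrite -[t * V]mul1r; apply: weight_cutoff => //.
  by rewrite normr1.
apply: (entropy_propagation L0 eta_convex etaL (rho := 2 * r + t2 * V) (l := r^-1)
  (psi := fun t => cutoff r (t * V))) => //.
- by rewrite addr_ge0// ?mulr_ge0// ltW.
- by rewrite invr_ge0 ltW.
- by move=> t /andP[t1t tt2]; apply: wt => //; exact: le_trans t1t.
move=> t h t1t h0 tht2.
have t0 := le_trans t10 t1t; have tt2 : t <= t2 by rewrite (le_trans _ tht2)// lerDl.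
have w1 := wt t t0 tt2.
have [ip lePp] := entropy_pos_part t10 t1t i1.
have k0 : 0 <= h * V * 2 / r by rewrite divr_ge0 ?mulr_ge0// ltW.
apply: (@le_trans _ _ (weighted_entropy eta (cutoff r (t * V)) t +
    h * V * 2 / r * \sum_i \int[m]_x Num.max (eta (g i x t)) 0)); last first.
  rewrite lerD2l [leRHS](_ : _ = h * V * 2 / r *
    \sum_i \int[m]_x Num.max (eta (g i x t1)) 0); last by ring.
  exact: ler_wpM2l.
apply: (@le_trans _ _ (\sum_i
    (\int[m]_x (cutoff r (t * V) x * eta (g i x t)) +
     h * V * 2 / r * \int[m]_x Num.max (eta (g i x t)) 0))); last first.
  by rewrite big_split/= -mulr_sumr.
apply: ler_sum => i _.
have w2 := is_weight_shift (h *: v i) (wt (t + h) (addr_ge0 t0 h0) tht2).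
have j1 := integrable_weight t w1 (leta i).
have j2 := integrableZ_EFin measurableT (h * V * 2 / r) (ip i).
rewrite -(RintegralZl _ measurableT (ip i)) -(RintegralD measurableT j1 j2).
apply: le_Rintegral => //.
- exact: (integrable_weight t w2 (leta i)).
- exact: (integrableD_EFin measurableT j1 j2).
move=> x _; have /andP[n1 n2] := norm_char i x h0.
have : cutoff r (t * V) x <= cutoff r ((t + h) * V) (x + h *: v i).
  by apply: cutoff_le => //; rewrite mulrDl; lra.
have : cutoff r ((t + h) * V) (x + h *: v i) <=
    cutoff r (t * V) x + h * V * 2 / r.
  by apply: cutoff_leD => //; [rewrite !mulr_ge0|rewrite mulrDl; lra].
(* Where [eta <= 0] a larger weight lowers the product; elsewhere the increase of the weight
   multiplies [eta] itself. *)
case: (leP (eta (g i x t)) 0) => [e0|/ltW e0] c1 c2.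
  by rewrite mulr0 addr0 ler_wnM2r.
by rewrite -mulrDl ler_wpM2r.
Qed.

(** With [r = k + 1] and [k] tending to infinity, both weighted entropies converge to the full
    integrals and the error is [c / (k + 1)]. *)
Lemma entropy_integral_le t1 t2 : 0 <= t1 -> t1 <= t2 ->
  (forall i, m.-integrable setT (fun x => (eta (g i x t1))%:E)) ->
  (forall i, m.-integrable setT (fun x => (eta (g i x t2))%:E)) ->
  \sum_i \int[m]_x eta (g i x t2) <= \sum_i \int[m]_x eta (g i x t1).
Proof.
move=> t10 t12 i1 i2.
have C t : (forall i, m.-integrable setT (fun x => (eta (g i x t))%:E)) ->
    weighted_entropy eta (cutoff k.+1%:R (t * V)) t @[k --> \oo] -->
    \sum_i \int[m]_x eta (g i x t).
  move=> it; apply: cvg_big => [|i _]; first exact: add_continuous.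
  exact: (@cutoff_integral_cvg _ _ _ (t * V) (it i)).
pose c := 2 * V * (\sum_i \int[m]_x Num.max (eta (g i x t1)) 0) * (t2 - t1).
have D : weighted_entropy eta (cutoff k.+1%:R (t1 * V)) t1 + c * harmonic k
    @[k --> \oo] -->
    \sum_i \int[m]_x eta (g i x t1).
  rewrite -[X in _ --> X]addr0; apply: cvgD; first exact: (C t1 i1).
  by rewrite -(mulr0 c); apply: cvgMl_tmp; exact: cvg_harmonic.
apply: (ler_cvg_to (C _ i2) D); apply: nearW => k.
have := entropy_cutoff_le (ltr0Sn R k) t10 t12 i1.
by congr (_ <= _ + _); rewrite /c /harmonic/=; ring.
Qed.

End propagation.

(** * From mild solutions to the entropy inequality *)

Lemma mild_solution_exchange (R : realType) (d n : nat) (v : 'I_n -> 'rV[R]_d)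
    (mu : 'I_n -> 'I_n -> R) (f : 'I_n -> 'rV[R]_d -> R -> R) :
  (forall i j, i != j -> mu i j = mu j i) -> mild_solution v mu f ->
  let g i x s := f i x (Num.max 0 s) in
  (forall i, locbnd (g i)) /\
  (forall i (a b : R), 0 <= a -> a <= b -> {ae lebesgue_rV d, forall x,
    g i (x + b *: v i) b - g i (x + a *: v i) a =
    \int[lebesgue_measure]_(s in `[a, b]) exchange v mu g i x s}).
Proof.
move=> mu_sym [fm fc feq] g.
have lg i : locbnd (g i) by exact: locbnd_time_extension.
split=> // i a b a0 ab; have b0 := le_trans a0 ab.
have lQ : locbnd (exchange v mu g i).
  apply: locbnd_sum => j _; apply: locbndZ; apply: locbndB.
    exact: (locbnd_trans (v i) (lg j)).
  exact: (locbnd_trans (v i) (lg i)).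
(* On [[0, t]] the extension [g] is [f], and symmetry turns [mu j i] into [mu i j]. *)
have E x (t : R) :
    \int[lebesgue_measure]_(s in `[0, t]) \sum_(j < n | j != i)
      (mu j i * f j (x + s *: v i) s - mu i j * f i (x + s *: v i) s) =
    \int[lebesgue_measure]_(s in `[0, t]) exchange v mu g i x s.
  apply: eq_Rintegral => s; rewrite inE/= in_itv/= => /andP[s0 _].
  apply: eq_bigr => j ji; rewrite /g max_r// mulrBr (mu_sym _ _ ji).
  by [].
apply: filterS3 (feq i a a0) (feq i b b0) (ae_integrable_trace lQ b0).
move=> x Ea Eb Qi.
rewrite /g max_r// max_r// Ea Eb !E opprD addrACA subrr add0r.
(* Subtracting the equations at [a] and [b] leaves an integral over the half-open interval; the
   endpoint [a] is then restored as a null set. *)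
rewrite (@Rintegral_itvB _ _ (BLeft 0) (BRight b) a)//.
apply: Rintegral_itv_obnd_cbnd.
by apply: (integrableS _ _ _ Qi) => //; apply: subset_itvr; rewrite bnd_simp.
Qed.

Theorem proposition2p1 (R : realType) (d n : nat) (d_ge1 : (1 <= d)%N)
    (n_ge1 : (1 <= n)%N) (v : 'I_n -> 'rV[R]_d) (mu : 'I_n -> 'I_n -> R)
    (mu_ge0 : forall i j, i != j -> 0 <= mu i j)
    (mu_sym : forall i j, i != j -> mu i j = mu j i)
    (eta : R -> R) (eta_lipschitz : lipschitz eta)
    (eta_convex : convex_function setT eta)
    (f : 'I_n -> 'rV[R]_d -> R -> R) (f_sol : mild_solution v mu f)
    (t1 t2 : R) (t1_ge0 : 0 <= t1) (t1_lt_t2 : t1 < t2)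
    (rhs_finite : forall i,
      (lebesgue_rV d).-integrable setT (fun x => (eta (f i x t1))%:E)) :
  (forall i, \int[lebesgue_rV d]_x (fun y => (eta (f i y t2))%:E)^\+ x < +oo)%E /\
  (\sum_(i < n) \int[lebesgue_rV d]_x (eta (f i x t2))%:E <=
   \sum_(i < n) \int[lebesgue_rV d]_x (eta (f i x t1))%:E)%E.
Proof.
have [L L0 etaL] := lipschitzP eta_lipschitz.
have [lg mild] := mild_solution_exchange mu_sym f_sol.
set g := (fun i x s => f i x (Num.max 0 s)) in lg mild.
have t12 := ltW t1_lt_t2; have t20 := le_trans t1_ge0 t12.
have gf i t : 0 <= t -> (fun x => eta (g i x t)) = (fun x => eta (f i x t)).
  by move=> t0; apply/funext => x; rewrite /g max_r.
have i1 i : (lebesgue_rV d).-integrable setT (fun x => (eta (g i x t1))%:E).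
  by have := rhs_finite i; congr (_.-integrable _ _); apply/funext => x; rewrite /g max_r.
have [pos _] := entropy_pos_part mu_ge0 mu_sym lg mild L0 eta_convex etaL t1_ge0 t12 i1.
have posE i : (fun y => (eta (f i y t2))%:E)^\+%E =
    (fun x => (Num.max (eta (g i x t2)) 0)%:E).
  by apply/funext => x; rewrite funeposE /g (max_r t20) EFin_max.
have posy i : (\int[lebesgue_rV d]_x (fun y => (eta (f i y t2))%:E)^\+ x < +oo)%E.
  by rewrite posE; apply: integrable_lty => //; exact: pos.
split=> //.
have mf i : measurable_fun setT (fun x => (eta (f i x t2))%:E).
  apply/measurable_EFinP; rewrite -gf//.
  by have := locbnd_slice t2 (locbnd_comp (lipschitz_measurable etaL) etaL (lg i)).
(* If all components are integrable at [t2], the real-valued inequality applies. Otherwise the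
   left-hand side is shown to be [-oo]. *)
have [i2|/existsNP[i ni]] := pselect (forall i,
    (lebesgue_rV d).-integrable setT (fun x => (eta (f i x t2))%:E)).
  have i2g i : (lebesgue_rV d).-integrable setT (fun x => (eta (g i x t2))%:E).
    by have := i2 i; congr (_.-integrable _ _); apply/funext => x; rewrite /g max_r.
  have le12 := entropy_integral_le mu_ge0 mu_sym lg mild L0 eta_convex etaL
    t1_ge0 t12 i1 i2g.
  have E t : 0 <= t ->
    (forall i, (lebesgue_rV d).-integrable setT (fun x => (eta (f i x t))%:E)) ->
    (\sum_(i < n) \int[lebesgue_rV d]_x (eta (f i x t))%:E =
     (\sum_(i < n) \int[lebesgue_rV d]_x eta (g i x t))%:E)%E.
    move=> t0 it; rewrite -sumEFin; apply: eq_bigr => i _.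
    by rewrite gf// /Rintegral fineK//; exact: integrable_fin_num.
  by rewrite !E// lee_fin.
rewrite [leLHS](_ : _ = -oo%E) ?leNye// (bigD1 i)//=.
(* One summand equal to [-oo] decides the sum: [-oo] absorbs under extended addition, and by [posy]
   no other summand is [+oo]. *)
rewrite [X in (X + _)%E](_ : _ = -oo%E) ?addNye//.
have finpos : (\int[lebesgue_rV d]_x (fun y => (eta (f i y t2))%:E)^\+ x \is a fin_num)%E.
  by rewrite ge0_fin_numE//; exact: integral_ge0.
rewrite integralE.
suff -> : (\int[lebesgue_rV d]_x (fun y => (eta (f i y t2))%:E)^\- x = +oo)%E.
  by rewrite -[X in (X - _)%E](fineK finpos).
(* A finite integral of the negative part, together with that of the positive part, would make
   component [i] integrable, against [ni]. *)
apply/eqP; rewrite -leye_eq leNgt; apply/negP => neg; apply: ni.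
apply/integrableP; split=> //.
rewrite (eq_integral (fun x => ((fun y => (eta (f i y t2))%:E)^\+ x +
    (fun y => (eta (f i y t2))%:E)^\- x))%E); last first.
  by move=> x _; rewrite -[LHS]/((abse \o (fun y => (eta (f i y t2))%:E)) x) fune_abse.
rewrite ge0_integralD//; first exact: lte_add_pinfty.
- exact: measurable_funepos.
- exact: measurable_funeneg.
Qed.
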